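(* Let $\Omega$ be the two-dimensional region described in the context, let $U$ be an admissible unitary operator on $L^2(\partial\Omega)$ with spectral gap at $-1$, let $P_U$ be the orthogonal projection onto its eigenspace for the eigenvalue $-1$ and let $A_U$ be its partial Cayley transform. Suppose that $P_U$ is a continuous operator with respect to the Sobolev norm of $\mathcal H^{1/2}(\partial\Omega)$. Let $K^N$ be the orthogonal projectors onto the subspaces of piecewise linear continuous functions on $\partial\Omega$ (with respect to the discretisation of $\partial\Omega$ described in the context), and suppose that they satisfy $$\|K^N\varphi\|_{\mathcal H^{1/2}(\partial\Omega)}\le c\,\|\varphi\|_{\mathcal H^{1/2}(\partial\Omega)} .$$ Let $$P_{U^N}:=K^NP_UK^N\qquad\text{and}\qquad A_{U^N}:=K^NA_UK^N .$$ Then: 1. $\|(P_{U^N}-P_U)\varphi\|_{\mathcal H^{1/2}(\partial\Omega)}\to0$ as $N\to\infty$, for every $\varphi\in\mathcal H^{1/2}(\partial\Omega)$; 2. $\langle\psi,(A_{U^N}-A_U)\varphi\rangle_{L^2(\partial\Omega)}\to0$ as $N\to\infty$, for every $\psi\in L^2(\partial\Omega)$ and every $\varphi\in\mathcal H^{1/2}(\partial\Omega)$.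
   Context: Region and discretisation. $\Omega=[0,1]\times[0,1]$ with the flat metric, with the corners regularised by identification so that $\partial\Omega$ is treated as a compact connected one-dimensional manifold (a closed curve, parameterised by arc length). The boundary is divided into $N_S$ consecutive intervals $I_j=[x_j,x_j+h]$, $1\le j\le N_S$, of equal length $h$, the last endpoint being identified with the first. $N$ labels the discretisation (it is the total number of finite element base-functions), and $N\to\infty$ corresponds to $N_S\to\infty$, $h\to0$. A piecewise linear continuous function is a continuous function on $\partial\Omega$ that is affine on each $I_j$; on each interval it is expanded in the $L^2$-orthonormal Legendre polynomials of order $0$ and $1$, $$P_0^j(x)=\tfrac{1}{\sqrt h},\qquad P_1^j(x)=\tfrac{2\sqrt3}{\sqrt{h^3}}\bigl(x-x_j-\tfrac h2\bigr),\qquad x\in I_j,$$ extended by zero outside $I_j$. $K^N$ is the orthogonal projector in $L^2(\partial\Omega)$; the constant $c$ does not depend on $N$ or $\varphi$. Unitary operators at the boundary. A unitary operator $U$ has spectral gap at $-1$ if either $\mathbb I+U$ is invertible, or $-1\in\sigma(U)$ and $-1$ is not an accumulation point of $\sigma(U)$. With $W$ the eigenspace of $U$ for the eigenvalue $-1$, $P_U$ is the orthogonal projection onto $W$ (zero if $-1\notin\sigma(U)$) and $P_U^\perp=\mathbb I-P_U$. The partial Cayley transform is the bounded operator $A_U:=i\,P_U^\perp(U-\mathbb I)(U+\mathbb I)^{-1}$ on $L^2(\partial\Omega)$, understood as $i(U-\mathbb I)(U+\mathbb I)^{-1}$ on $\operatorname{ran}P_U^\perp$ and $0$ on $W$. $U$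 is admissible if $A_U$ leaves $\mathcal H^{1/2}(\partial\Omega)$ (the Sobolev space of order $1/2$) invariant and there is $K\in\mathbb R$ with $\|A_U\varphi\|_{\mathcal H^{1/2}(\partial\Omega)}\le K\|\varphi\|_{\mathcal H^{1/2}(\partial\Omega)}$ for all $\varphi\in\mathcal H^{1/2}(\partial\Omega)$. *)

(* Defs.v *)
From HB Require Import structures.
From mathcomp Require Import all_boot all_order all_algebra.
From mathcomp Require Import ring_quotient.
From mathcomp Require Import all_classical all_reals all_analysis.
From mathcomp Require Import complex.

Set Implicit Arguments.
Unset Strict Implicit.
Unset Printing Implicit Defensive.
Import Order.TTheory GRing.Theory Num.Theory.
Import numFieldNormedType.Exports.
Local Open Scope classical_set_scope.
Local Open Scope ring_scope.

(* The boundary of [0,1] x [0,1] is a closed curve of length 4, identified with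
   R/4Z by arc length: functions on it are considered on [0, 4[, and a
   continuous function on it is a continuous 4-periodic function on R. *)
Definition perimeter (R : realType) : R := 4.

Definition bdry_measure (R : realType) :
    {measure set (measurableTypeR R) -> \bar R} :=
  mrestr lebesgue_measure
    (measurable_itv `[0, perimeter R[ : measurable (`[0, perimeter R[ : set R)).

(* Functions take values in R[i]^o and not in R[i], so that they form a module
   over R[i]: R[i] alone carries its module structure over R. *)
Section SquareIntegrable.
Variable R : realType.
Notation mu := (bdry_measure R).
Definition sq_integrable : {pred R -> R[i]^o} := [pred f : R -> R[i]^o |
  ((fun x => complex.Re (f x)) \in Lfun mu 2%:E) &&
  ((fun x => complex.Im (f x)) \in Lfun mu 2%:E)].

Lemma sq_integrable_submod_closed : submod_closed sq_integrable.
Proof.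
have two : (1 <= 2%:E :> \bar R)%E by rewrite lee_fin ler1n.
have [L0 LZ] := Lfun_submod_closed mu two.
split=> [|a f g /andP[rf jf] /andP[rg jg]].
  apply/andP; split; exact: L0.
apply/andP; split.
- suff -> : (fun x => complex.Re ((a *: f + g) x)) =
      complex.Re a *: (fun x => complex.Re (f x)) +
      ((- complex.Im a) *: (fun x => complex.Im (f x)) +
       (fun x => complex.Re (g x))) :> (R -> R).
    by apply: (LZ) => //; apply: (LZ).
  apply/funext => x; rewrite !fctE.
  case: (a) (f x) (g x) => [a1 a2] [f1 f2] [g1 g2].
  change (a1 * f1 - a2 * f2 + g1 = a1 * f1 + (- a2 * f2 + g1)).
  by rewrite mulNr addrA.
- suff -> : (fun x => complex.Im ((a *: f + g) x)) =
      complex.Re a *: (fun x => complex.Im (f x)) +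
      (complex.Im a *: (fun x => complex.Re (f x)) +
       (fun x => complex.Im (g x))) :> (R -> R).
    by apply: (LZ) => //; apply: (LZ).
  apply/funext => x; rewrite !fctE.
  case: (a) (f x) (g x) => [a1 a2] [f1 f2] [g1 g2].
  change (a1 * f2 + a2 * f1 + g2 = a1 * f2 + (a2 * f1 + g2)).
  by rewrite addrA.
Qed.

HB.instance Definition _ := GRing.isSubmodClosed.Build _ _ sq_integrable
  sq_integrable_submod_closed.

Record L2fun := MkL2fun {
  L2fun_val :> R -> R[i]^o;
  L2fun_sq_integrable : L2fun_val \in sq_integrable }.

HB.instance Definition _ := [isSub for L2fun_val].
HB.instance Definition _ := [Choice of L2fun by <:].
HB.instance Definition _ := [SubChoice_isSubLmodule of L2fun by <:].

Definition ae_null : {pred L2fun} :=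
  [pred f : L2fun | `[< {ae mu, forall x, f x = 0} >]].

Lemma ae_null_submod_closed : submod_closed ae_null.
Proof.
split=> [|a f g].
  by apply/asboolP; apply: aeW => x.
move=> /asboolP f0 /asboolP g0; apply/asboolP.
have aeF : Filter (almost_everywhere mu) by exact: ae_filter_ringOfSetsType.
move: f0 g0; apply: (@filterS2 _ _ aeF) => x fx gx.
change (a *: (f x) + g x = 0).
by rewrite fx gx scaler0 addr0.
Qed.

HB.instance Definition _ := GRing.isSubmodClosed.Build _ _ ae_null
  ae_null_submod_closed.

Definition L2 : Type := Quotient.quot ae_null.

HB.instance Definition _ := GRing.Zmodule.on L2.
HB.instance Definition _ := EqQuotient.on L2.

Local Open Scope quotient_scope.

Definition L2_class (f : L2fun) : L2 := \pi_(Quotient.quot ae_null) f.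
Definition L2_repr (f : L2) : L2fun := repr (f : Quotient.quot ae_null).

Lemma L2_reprK (f : L2) : L2_class (L2_repr f) = f.
Proof. exact: reprK. Qed.

Lemma L2_class_eqP (f g : L2fun) :
  L2_class f = L2_class g <-> {ae mu, forall x, f x = g x}.
Proof.
have -> : {ae mu, forall x, f x = g x} = {ae mu, forall x, (f - g) x = 0}.
  congr (almost_everywhere _ _); apply/funext => x; apply/propext.
  change ((f x = g x) <-> (f x - g x = 0)).
  by split=> [->|/eqP]; rewrite ?subrr// subr_eq0 => /eqP.
rewrite -(asboolE {ae mu, forall x, (f - g) x = 0}).
change ((L2_class f = L2_class g) <-> (f - g \in ae_null)).
by rewrite Quotient.idealrBE; split=> /eqP.
Qed.

Lemma L2_classD (f g : L2fun) : L2_class (f + g) = L2_class f + L2_class g.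
Proof. exact: Quotient.pi_add. Qed.

Definition L2_scale (a : R[i]) (f : L2) : L2 := L2_class (a *: L2_repr f).

Lemma L2_classZ a (f : L2fun) : L2_class (a *: f) = L2_scale a (L2_class f).
Proof.
apply/eqP; rewrite -Quotient.idealrBE -scalerBr; apply: rpredZ.
by rewrite Quotient.idealrBE; apply/eqP/esym; exact: L2_reprK.
Qed.

Implicit Types f g : L2.

Fact L2_scaleA a b f : L2_scale a (L2_scale b f) = L2_scale (a * b) f.
Proof. by rewrite -[f]L2_reprK -!L2_classZ scalerA. Qed.

Fact L2_scale1 : left_id 1 L2_scale.
Proof. by move=> f; rewrite -[f]L2_reprK -L2_classZ scale1r. Qed.

Fact L2_scaleDr : right_distributive L2_scale +%R.
Proof.
move=> a f g; rewrite -[f]L2_reprK -[g]L2_reprK -L2_classD -!L2_classZ.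
by rewrite scalerDr L2_classD.
Qed.

Fact L2_scaleDl f : {morph L2_scale^~ f : a b / a + b}.
Proof.
by move=> a b; rewrite -[f]L2_reprK -!L2_classZ scalerDl L2_classD.
Qed.

HB.instance Definition _ := GRing.Zmodule_isLmodule.Build R[i] L2
  L2_scaleA L2_scale1 L2_scaleDr L2_scaleDl.

End SquareIntegrable.

Definition cintegral (R : realType) (f : R -> R[i]) : R[i] :=
  Complex (\int[bdry_measure R]_x complex.Re (f x))%R
          (\int[bdry_measure R]_x complex.Im (f x))%R.

Section Boundary.
Variable R : realType.
Notation C := R[i].
Notation H := (L2 R).
Implicit Types (f g : H) (T : H -> H) (V : set H).

(* Antilinear in the first argument. *)
Definition inner f g : C :=
  cintegral (fun x => (L2_repr f x)^*%C * L2_repr g x).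

Definition L2_norm f : R := Num.sqrt (complex.Re (inner f f)).

Definition unitary_op T : Prop :=
  (forall f g, inner (T f) (T g) = inner f g) /\ (forall g, exists f, T f = g).

Definition bounded_inverse T : Prop :=
  exists S : {linear H -> H},
    [/\ cancel T S, cancel S T &
       exists M : R, forall f, L2_norm (S f) <= M * L2_norm f].

Definition spectrum_op T : set C^o :=
  [set z | ~ bounded_inverse (fun f => T f - z *: f)].

Definition spectral_gap T : Prop :=
  bounded_inverse (fun f => f + T f) \/
  (spectrum_op T (-1) /\ ~ limit_point (spectrum_op T) (-1)).

Definition eigenspace_op T (z : C) : set H := [set f | T f = z *: f].

Definition orth_complement V : set H :=
  [set f | forall v, V v -> inner v f = 0].

Definition is_orth_proj T V : Prop :=
  forall f, V (T f) /\ orth_complement V (f - T f).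

(* On the orthogonal complement of W, which is the range of the projection
   I - P_U, the map I + U is injective, so (U + I)^-1 f is the only g there
   with U g + g = f. *)
Definition is_partial_cayley (U : H -> H) (A : {linear H -> H}) : Prop :=
  let W := eigenspace_op U (-1) in
  (forall f, W f -> A f = 0) /\
  (forall f, orth_complement W f ->
     exists g, [/\ orth_complement W g, U g + g = f &
                    A f = 'i%C *: (U g - g)]).

(* (4^{-1/2} e^{2 pi i k x / 4})_k is the orthonormal basis of eigenfunctions of
   the Laplacian of the curve, and (2 pi k / 4)^2 are the eigenvalues of its
   opposite. *)
Definition frequency (k : int) : R := 2 * pi * k%:~R / perimeter R.

Definition fourier_mode (k : int) (x : R) : C :=
  (Num.sqrt (perimeter R))^-1%:C%C *
  Complex (cos (frequency k * x)) (sin (frequency k * x)).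

Definition fourier_coef f (k : int) : C :=
  cintegral (fun x => (fourier_mode k x)^*%C * L2_repr f x).

(* The norm <f, (I - Laplacian)^s f>^{1/2}, with value +oo outside the Sobolev
   space of order s. *)
Definition sobolev_norm (s : R) f : \bar R :=
  ((\esum_(k in [set: int])
     ((1 + frequency k ^+ 2) `^ s *
      ComplexField.Normc.normc (fourier_coef f k) ^+ 2)%:E)
   `^ 2^-1)%E.

Definition H12_norm f : \bar R := sobolev_norm 2^-1 f.

Definition H12 : set H := [set f | (H12_norm f < +oo)%E].

Definition admissible (U : H -> H) : Prop :=
  exists2 A : {linear H -> H}, is_partial_cayley U A &
    (forall f, H12 f -> H12 (A f)) /\
    exists M : R, forall f, H12 f -> (H12_norm (A f) <= M%:E * H12_norm f)%E.

Definition H12_continuous T : Prop :=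
  (forall f, H12 f -> H12 (T f)) /\
  (forall f, H12 f -> forall e : R, 0 < e ->
     exists2 d : R, 0 < d & forall g, H12 g ->
       (H12_norm (g - f)%R < d%:E)%E -> (H12_norm (T g - T f)%R < e%:E)%E).

(* The mesh of n intervals of equal length with first node x1; its last node
   x1 + 4 is the same boundary point as x1. *)
Definition node (n : nat) (x1 : R) (j : nat) : R :=
  x1 + j%:R * (perimeter R / n%:R).

Definition piecewise_linear (n : nat) (x1 : R) (u : R -> C^o) : Prop :=
  [/\ continuous u, periodic u (perimeter R) &
     forall j, (j < n)%N -> exists a b : C,
       {in `[node n x1 j, node n x1 j.+1], forall x, u x = a + x%:C%C * b}].

Definition PL_space (n : nat) (x1 : R) : set H :=
  [set f | exists2 u, piecewise_linear n x1 u &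
     {ae bdry_measure R, forall x, L2_repr f x = u x}].

End Boundary.

(* Main.v *)
From HB Require Import structures.
Require Import Defs.
From mathcomp Require Import all_boot all_order all_algebra.
From mathcomp Require Import all_classical all_reals all_analysis measurable_realfun.
From mathcomp Require Import complex ring lra.
Import Order.TTheory GRing.Theory Num.Theory.
Import numFieldNormedType.Exports HBNNSimple.
Local Open Scope classical_set_scope.
Local Open Scope ring_scope.

Set Implicit Arguments.
Unset Strict Implicit.
Unset Printing Implicit Defensive.

(* Any sequence of stable projectors which fixes the piecewise linear functions
   converges strongly in H^{1/2}: truncating the Fourier series reduces this to
   a single mode t, and K t - t = K (t - I t) - (t - I t) for the piecewise
   linear interpolant I t.  The error t - I t is O(h^2) with Lipschitz constant
   O(h), and Bessel's inequality for its difference quotients bounds its H^1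
   norm, hence its H^{1/2} norm, by O(h).  Then
     K T K f - T f = K T (K f - f) + (K T f - T f)
   tends to 0 in H^{1/2} whenever T is continuous there.  For T = A this gives
   the weak convergence, since the L^2 norm is at most the H^{1/2} norm; that
   is Parseval's inequality, so it needs the completeness of the Fourier modes.
   Completeness is obtained from trigonometric polynomials (1 - s^n)^(2^n)
   converging to the indicators of rays, and Dynkin's theorem. *)

Local Notation Re := complex.Re.
Local Notation Im := complex.Im.

(** * The inner product of the boundary *)

(** The hypotheses and the first conclusion use an extended-real norm built from Fourier
    coefficients. The argument runs instead on [sobolev_le f B], a real bound on every finite sum of
    the squared norm, indexed by duplicate-free lists of frequencies. Squares obey |z + w|^2 <= 2
    |z|^2 + 2 |w|^2, which replaces the triangle inequality at the price of harmless constants. The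
    reduction to single modes rests on the bound [c] being uniform in N: the tail of the series then
    costs a fixed factor. The first node [x1 N] may move with N, so the interpolation error must be
    uniform in the origin of the mesh. The norm sees a function only through its coefficients,
    whereas the weak limit pairs it with an arbitrary element of L^2; a nonzero function with
    vanishing coefficients would break the argument, hence the need for completeness. Admissibility
    provides some partial Cayley transform with an H^{1/2} bound; uniqueness identifies it with the
    given [A]. *)

Definition sqnormc (R : realType) (z : R[i]) : R := Re z ^+ 2 + Im z ^+ 2.

Section ComplexParts.
Variable R : realType.
Implicit Types z w : R[i].

Lemma complex_eqP z w : Re z = Re w -> Im z = Im w -> z = w.
Proof. by case: z w => [? ?] [? ?] /= -> ->. Qed.

Lemma ReD z w : Re (z + w) = Re z + Re w. Proof. by case: z w => [? ?] []. Qed.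
Lemma ImD z w : Im (z + w) = Im z + Im w. Proof. by case: z w => [? ?] []. Qed.
Lemma ReN z : Re (- z) = - Re z. Proof. by case: z. Qed.
Lemma ImN z : Im (- z) = - Im z. Proof. by case: z. Qed.
Lemma ReM z w : Re (z * w) = Re z * Re w - Im z * Im w.
Proof. by case: z w => [? ?] []. Qed.
Lemma ImM z w : Im (z * w) = Re z * Im w + Im z * Re w.
Proof. by case: z w => [? ?] []. Qed.
Lemma ReJ z : Re z^*%C = Re z. Proof. by case: z. Qed.
Lemma ImJ z : Im z^*%C = - Im z. Proof. by case: z. Qed.

Definition cpartE := (ReD, ImD, ReN, ImN, ReM, ImM, ReJ, ImJ).

Lemma sqnormc_ge0 z : 0 <= sqnormc z.
Proof. by rewrite addr_ge0 ?sqr_ge0. Qed.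

Lemma mulCJ_sqnormc z : z * z^*%C = (sqnormc z)%:C%C.
Proof. by apply: complex_eqP; rewrite !cpartE/= /sqnormc; ring. Qed.

Lemma sqnormcM z w : sqnormc (z * w) = sqnormc z * sqnormc w.
Proof. by rewrite /sqnormc !cpartE; ring. Qed.

Lemma sqr_normc_sqnormc z : ComplexField.Normc.normc z ^+ 2 = sqnormc z.
Proof. by case: z => a b; rewrite sqr_sqrtr // addr_ge0 ?sqr_ge0. Qed.

Lemma sqnormc_eq0 z : sqnormc z = 0 -> z = 0.
Proof.
move/eqP; rewrite paddr_eq0 ?sqr_ge0 // !sqrf_eq0 => /andP[/eqP a0 /eqP b0].
by apply: complex_eqP.
Qed.

Lemma sqnormcD z w : sqnormc (z + w) <= 2 * sqnormc z + 2 * sqnormc w.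
Proof.
rewrite /sqnormc !cpartE; have := sqr_ge0 (Re z - Re w).
by have := sqr_ge0 (Im z - Im w); nra.
Qed.

End ComplexParts.

(** Locked so that simplification does not unfold it down to an integral of representatives. *)
HB.lock Definition sqnorm (R : realType) (f : L2 R) : R := Re (inner f f).

(** * Classes of square-integrable functions and their inner product *)

Section L2Inner.
Variable R : realType.
Notation mu := (bdry_measure R).
Notation C := R[i].
Notation H := (L2 R).

Definition cintegrable (f : R -> C) : Prop :=
  mu.-integrable setT (EFin \o (fun x => Re (f x))) /\
  mu.-integrable setT (EFin \o (fun x => Im (f x))).

Lemma cintegralD (f g : R -> C) : cintegrable f -> cintegrable g ->
  cintegral (fun x => f x + g x) = cintegral f + cintegral g.
Proof.
move=> [rf jf] [rg jg]; apply: complex_eqP; rewrite !cpartE /=.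
  by under eq_Rintegral do rewrite ReD; rewrite RintegralD.
by under eq_Rintegral do rewrite ImD; rewrite RintegralD.
Qed.

Lemma integrable_scale (a : R) (f : R -> R) :
  mu.-integrable setT (EFin \o f) -> mu.-integrable setT (EFin \o (fun x => a * f x)).
Proof.
move=> fi; have := integrableZl measurableT a fi.
by apply: eq_integrable => // x _ /=; rewrite EFinM.
Qed.

Lemma cintegralZ (a : C) (f : R -> C) : cintegrable f ->
  cintegral (fun x => a * f x) = a * cintegral f.
Proof.
move=> [rf jf]; apply: complex_eqP; rewrite !cpartE /=.
  under eq_Rintegral do rewrite ReM.
  by rewrite RintegralB ?RintegralZl//; exact: integrable_scale.
under eq_Rintegral do rewrite ImM.
by rewrite RintegralD ?RintegralZl//; exact: integrable_scale.
Qed.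

Lemma cintegralJ (f : R -> C) : cintegrable f ->
  cintegral (fun x => (f x)^*%C) = (cintegral f)^*%C.
Proof.
move=> [rf jf]; apply: complex_eqP; rewrite !cpartE /=.
  by under eq_Rintegral do rewrite ReJ.
under eq_Rintegral do rewrite ImJ -mulN1r.
by rewrite RintegralZl// mulN1r.
Qed.

Lemma ae_eq_cintegral (f g : R -> C) : cintegrable f -> cintegrable g ->
  {ae mu, forall x, f x = g x} -> cintegral f = cintegral g.
Proof.
move=> [rf jf] [rg jg] fg.
have aeF : Filter (almost_everywhere mu) by exact: ae_filter_ringOfSetsType.
apply: complex_eqP => /=; congr fine;
  apply: ae_eq_integral => //; try exact: (measurable_int mu).
- by move: fg; apply: filterS => x fgx _ /=; rewrite fgx.
- by move: fg; apply: filterS => x fgx _ /=; rewrite fgx.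
Qed.

(** Made total, with default value 0, so that classes can be formed from plain functions without
    carrying integrability proofs in terms. *)
Definition L2_of (f : R -> C) : H :=
  if pselect ((f : R -> C^o) \in @sq_integrable R) is left p
  then L2_class (MkL2fun p) else 0.

Definition sqi (f : R -> C) : Prop := (f : R -> C^o) \in @sq_integrable R.

Lemma L2_ofE (f : R -> C) (p : sqi f) : L2_of f = L2_class (MkL2fun p).
Proof.
rewrite /L2_of; case: pselect => [q|//].
by congr (L2_class (MkL2fun _)); exact: bool_irrelevance.
Qed.

Lemma sqi_repr (f : H) : sqi (L2_repr f).
Proof. exact: L2fun_sq_integrable. Qed.

Lemma L2_of_repr (f : H) : L2_of (L2_repr f) = f.
Proof.
rewrite -[RHS]L2_reprK (L2_ofE (sqi_repr f)); congr L2_class.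
exact: val_inj.
Qed.

Lemma L2_of_ae (f g : R -> C) : sqi f -> sqi g ->
  L2_of f = L2_of g <-> {ae mu, forall x, f x = g x}.
Proof. by move=> sf sg; rewrite (L2_ofE sf) (L2_ofE sg); exact: L2_class_eqP. Qed.

Lemma repr_L2_of (f : R -> C) : sqi f ->
  {ae mu, forall x, L2_repr (L2_of f) x = f x}.
Proof. by move=> sf; apply/L2_of_ae => //; [exact: sqi_repr|rewrite L2_of_repr]. Qed.

Lemma sqiD (f g : R -> C) : sqi f -> sqi g -> sqi (fun x => f x + g x).
Proof.
rewrite /sqi => sf sg.
exact: (@rpredD _ (@sq_integrable R) (f : R -> C^o) (g : R -> C^o)).
Qed.

Lemma sqiZ a (f : R -> C) : sqi f -> sqi (fun x => a * f x).
Proof.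
rewrite /sqi => sf.
exact: (@rpredZ C _ (@sq_integrable R) a (f : R -> C^o)).
Qed.

Lemma L2_ofD (f g : R -> C) : sqi f -> sqi g ->
  L2_of (fun x => f x + g x) = L2_of f + L2_of g.
Proof.
move=> sf sg; rewrite (L2_ofE sf) (L2_ofE sg) (L2_ofE (sqiD sf sg)).
rewrite -L2_classD; congr L2_class; exact: val_inj.
Qed.

Lemma L2_ofZ a (f : R -> C) : sqi f ->
  L2_of (fun x => a * f x) = a *: L2_of f.
Proof.
move=> sf; rewrite (L2_ofE sf) (L2_ofE (sqiZ a sf)).
rewrite [RHS]/(@GRing.scale _ _ _ _)/=.
by rewrite -L2_classZ; congr L2_class; exact: val_inj.
Qed.

Lemma sqi_parts (f : R -> C) : sqi f <->
  ((fun x => Re (f x)) \in Lfun mu 2%:E /\ (fun x => Im (f x)) \in Lfun mu 2%:E).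
Proof. by split=> [/andP|]; [|move=> [? ?]; apply/andP]. Qed.

Lemma Lfun2_mul_integrable (f g : R -> R) :
  f \in Lfun mu 2%:E -> g \in Lfun mu 2%:E ->
  mu.-integrable setT (EFin \o (fun x => f x * g x)).
Proof. by move=> lf lg; apply/Lfun1_integrable; exact: Lfun2_mul_Lfun1. Qed.

Lemma sqi_mul (f g : R -> C) : sqi f -> sqi g ->
  cintegrable (fun x => (f x)^*%C * g x).
Proof.
move=> /sqi_parts[rf jf] /sqi_parts[rg jg].
have i1 := Lfun2_mul_integrable rf rg; have i2 := Lfun2_mul_integrable jf jg.
have i3 := Lfun2_mul_integrable rf jg; have i4 := Lfun2_mul_integrable jf rg.
split.
- have := integrableD measurableT i1 i2.
  by apply: eq_integrable => // x _ /=; rewrite !cpartE -EFinD mulNr opprK.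
- have := integrableB measurableT i3 i4.
  by apply: eq_integrable => // x _ /=; rewrite !cpartE -EFinB mulNr.
Qed.

Lemma inner_L2_of (f g : R -> C) : sqi f -> sqi g ->
  inner (L2_of f) (L2_of g) = cintegral (fun x => (f x)^*%C * g x).
Proof.
move=> sf sg; apply: ae_eq_cintegral; [exact: sqi_mul (sqi_repr _) (sqi_repr _) | exact: sqi_mul |].
have := repr_L2_of sg; have := repr_L2_of sf.
have aeF : Filter (almost_everywhere mu) by exact: ae_filter_ringOfSetsType.
by apply: filterS2 => x -> ->.
Qed.

Lemma inner_L2_ofr f (g : R -> C) : sqi g ->
  inner f (L2_of g) = cintegral (fun x => (L2_repr f x)^*%C * g x).
Proof. by move=> sg; rewrite -[in LHS](L2_of_repr f) inner_L2_of//; exact: sqi_repr. Qed.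

Implicit Types f g h : H.

Lemma innerDr f g h : inner f (g + h) = inner f g + inner f h.
Proof.
rewrite -[g]L2_of_repr -[h]L2_of_repr -L2_ofD; try exact: sqi_repr.
rewrite !inner_L2_ofr; try by [exact: sqi_repr|exact: sqiD (sqi_repr _) (sqi_repr _)].
rewrite -cintegralD; try exact: sqi_mul (sqi_repr _) (sqi_repr _).
by congr cintegral; apply/funext => x; rewrite mulrDr.
Qed.

Lemma innerZr a f g : inner f (a *: g) = a * inner f g.
Proof.
rewrite -[g]L2_of_repr -L2_ofZ; try exact: sqi_repr.
rewrite !inner_L2_ofr; try by [exact: sqi_repr|exact: sqiZ (sqi_repr _)].
rewrite -cintegralZ; try exact: sqi_mul (sqi_repr _) (sqi_repr _).
by congr cintegral; apply/funext => x; rewrite mulrCA.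
Qed.

Lemma innerC f g : inner g f = (inner f g)^*%C.
Proof.
rewrite -cintegralJ; last exact: sqi_mul (sqi_repr _) (sqi_repr _).
congr cintegral; apply/funext => x.
by apply: complex_eqP; rewrite !cpartE; ring.
Qed.

Lemma sqnorm_inner f : sqnorm f = Re (inner f f).
Proof. by rewrite unlock. Qed.

Lemma inner_sqnorm f : inner f f = (sqnorm f)%:C%C.
Proof.
have /(congr1 (@Im R)) := innerC f f.
by rewrite sqnorm_inner; case: (inner f f) => a b /= bN; congr Complex; lra.
Qed.

Lemma sqnormE f : sqnorm f = \int[mu]_x sqnormc (L2_repr f x).
Proof. by rewrite sqnorm_inner; apply: eq_Rintegral => x _; rewrite !cpartE /sqnormc; ring. Qed.

Lemma sqnorm_ge0 f : 0 <= sqnorm f.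
Proof. by rewrite sqnormE; apply: Rintegral_ge0 => x _; exact: sqnormc_ge0. Qed.

Lemma sqnorm_eq0 f : sqnorm f = 0 -> f = 0.
Proof.
have sf := sqi_repr f; have [rf jf] := sqi_mul sf sf.
have mf : mu.-integrable setT (EFin \o (fun x => sqnormc (L2_repr f x))).
  apply: eq_integrable rf => // x _ /=; rewrite !cpartE /sqnormc; congr EFin; ring.
rewrite sqnormE /Rintegral => f0.
have I0 : (\int[mu]_x `|(sqnormc (L2_repr f x))%:E| = 0)%E.
  under eq_integral do rewrite gee0_abs ?lee_fin ?sqnormc_ge0//.
  rewrite -[LHS]fineK ?f0//.
  exact: (@integrable_fin_num _ _ _ mu setT measurableT _ mf).
have /(ae_eq_integral_abs mu measurableT (measurable_int mu mf)) z0 := I0.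
rewrite -[f]L2_of_repr -[RHS]L2_of_repr; apply/L2_of_ae; try exact: sqi_repr.
have s0 : sqi (fun=> 0) by rewrite /sqi; exact: (@rpred0 _ (@sq_integrable R)).
have L0 : L2_of (fun=> 0) = 0 :> H.
  by have := L2_ofZ 0 s0; rewrite scale0r => <-; congr L2_of; apply/funext => x; rewrite mul0r.
have := repr_L2_of s0; rewrite L0.
have aeF : Filter (almost_everywhere mu) by exact: ae_filter_ringOfSetsType.
move: z0; apply: filterS2 => x + ->.
by move=> /(_ I) [] /sqnormc_eq0.
Qed.

End L2Inner.

(** * Translation invariance and the Fourier modes *)

Section BoundaryIntegral.
Variable R : realType.
Notation mu := (bdry_measure R).
Notation leb := (@lebesgue_measure R).

Lemma bdry_measure_setT : mu setT = 4%:E.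
Proof.
rewrite /bdry_measure /= /mrestr setTI /perimeter.
rewrite [LHS]lebesgue_measure_itv /= lte_fin ltr0n /=.
by rewrite -EFinB subr0.
Qed.

Lemma bdry_measure_lty : (mu setT < +oo)%E.
Proof. by rewrite bdry_measure_setT ltry. Qed.

Lemma bdry_measure_setC : mu (~` `[0, perimeter R[) = 0%E.
Proof. by rewrite /bdry_measure /= /mrestr setICl measure0. Qed.

Lemma bdry_integrable_bounded (f : R -> R) (M : R) :
  measurable_fun setT f -> (forall x, `|f x| <= M) ->
  mu.-integrable setT (EFin \o f).
Proof.
move=> mf fM; apply: measurable_bounded_integrable => //; first exact: bdry_measure_lty.
exists M; split; rewrite ?num_real// => x Mx y _ /=.
exact: le_trans (fM y) (ltW Mx).
Qed.

(** The fundamental theorem of calculus is applied on a closed interval, whereas the measure is the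
    restriction to [[0, 4[]; the endpoint 4 is a null set. *)
Lemma bdry_RintegralE (f : R -> R) : mu.-integrable setT (EFin \o f) ->
  leb.-integrable `[0, 4] (EFin \o f) ->
  \int[mu]_x f x = \int[leb]_(x in `[0, 4]) f x.
Proof.
move=> fi fl; rewrite -Rintegral_itv_bndo_bndc; last first.
  by apply: integrableS fl => //; apply: subset_itvl; rewrite bnd_simp.
congr fine.
rewrite (@negligible_integral _ _ _ mu setT (~` `[0, perimeter R[) (EFin \o f))//.
- rewrite setTD setCK; apply: eq_measure_integral => A mA Asub.
  by rewrite /bdry_measure /= /mrestr setIidl.
- exact: measurableC.
- exact: bdry_measure_setC.
Qed.

(** As a function of s, the integral over [[s, 4 + s]] has derivative [F (s + 4) - F s], which
    vanishes by periodicity; the mean value theorem then makes it constant. *)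
Lemma periodic_integral_shift (F : R -> R) (M : R) (d : R) :
  continuous F -> periodic F 4 -> (forall x, `|F x| <= M) -> 0 < d ->
  \int[mu]_x F (x + d) = \int[mu]_x F x.
Proof.
move=> cF pF FM d0.
have cshift s : continuous (fun x : R => F (x + s)).
  move=> x; apply: (@continuous_comp _ _ _ (fun x => x + s) F); last exact: cF.
  by apply: continuousD; [exact: cvg_id|exact: cvg_cst].
have int_itv (f : R -> R) (a b : R) : continuous f -> leb.-integrable `[a, b] (EFin \o f).
  move=> cf; apply: continuous_compact_integrable; first exact: segment_compact.
  exact: continuous_subspaceT.
have mcont (f : R -> R) : continuous f -> measurable_fun setT f.
  exact: continuous_measurable_fun.
have bint (s : R) : mu.-integrable setT (EFin \o (fun x => F (x + s))).
  by apply: (@bdry_integrable_bounded _ M) => [|x]; [exact: mcont|exact: FM].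
have bint0 : mu.-integrable setT (EFin \o F).
  by apply: (@bdry_integrable_bounded _ M) => [|x]; [exact: mcont|exact: FM].
rewrite (bdry_RintegralE (bint d) (int_itv _ _ _ (cshift d))).
rewrite (bdry_RintegralE bint0 (int_itv _ _ _ cF)).
(* Starting the primitive at -1 instead of 0 makes it differentiable on both sides at 0, so the
   endpoint needs no one-sided derivative. *)
pose Phi (y : R) : R := \int[leb]_(t in `[-1, y]) F t.
have dPhi (y : R) : -1 < y -> is_derive y 1 Phi (F y).
  move=> y1.
  have [|dy Dy] := @continuous_FTC1_closed R F (-1) y (y + 1) _ (int_itv _ _ _ cF) y1 (cF y).
    by rewrite ltrDl.
  by rewrite -Dy derive1E; exact: derivableP.
have dPhis (s x : R) : 0 <= s -> -1 < x -> is_derive x 1 (fun x => Phi (x + s)) (F (x + s)).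
  move=> s0 x0; have x1 : -1 < x + s by lra.
  have D1 := dPhi _ x1.
  have D2 : is_derive x 1 (fun x : R => x + s) 1.
    have := is_deriveD (is_derive_id x (1 : R)) (is_derive_cst s x (1 : R)).
    by rewrite addr0.
  by have := @is_derive1_comp _ Phi (fun x => x + s) x _ _ D1 D2; rewrite mulr1.
have FTC (s : R) : 0 <= s -> \int[leb]_(x in `[0, 4]) F (x + s) = Phi (4 + s) - Phi (0 + s).
  move=> s0.
  have cP x : -1 < x -> {for x, continuous (fun x => Phi (x + s))}.
    move=> x1; apply: differentiable_continuous; apply/derivable1_diffP.
    by have [] := dPhis _ _ s0 x1.
  have oo : derivable_oo_LRcontinuous (fun x => Phi (x + s)) 0 4.
    split.
    + move=> x; rewrite in_itv/= => /andP[x0 _].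
      by have [] := dPhis s x s0 (lt_trans (ltrN10 R) x0).
    + by apply: cvg_at_right_filter; apply: cP; lra.
    + by apply: cvg_at_left_filter; apply: cP; lra.
  have dd : {in `]0, 4[, derive1 (fun x => Phi (x + s)) =1 (fun x => F (x + s))}.
    move=> x; rewrite in_itv/= => /andP[x0 _].
    have D := dPhis s x s0 (lt_trans (ltrN10 R) x0).
    by rewrite derive1E (@derive_val _ _ _ _ _ _ _ D).
  have c04 : {within `[0, 4], continuous (fun x => F (x + s))}.
    exact: continuous_subspaceT.
  by rewrite /Rintegral (continuous_FTC2 _ c04 oo dd).
rewrite (FTC _ (ltW d0)).
have -> : \int[leb]_(x in `[0, 4]) F x = Phi (4 + 0) - Phi (0 + 0).
  by rewrite -FTC//; apply: eq_Rintegral => x _; rewrite addr0.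
have dth (x : R) : -1 < x -> is_derive x 1 (fun s => Phi (s + 4) - Phi (s + 0)) (F (x + 4) - F (x + 0)).
  by move=> x1; apply: is_deriveB; exact: dPhis.
have D0 x : x \in `]0, d[%R -> is_derive x 1 (fun s => Phi (s + 4) - Phi (s + 0)) (F (x + 4) - F (x + 0)).
  rewrite in_itv/= => /andP[x0 _]; apply: dth; lra.
have W0 : {within `[0, d], continuous (fun s => Phi (s + 4) - Phi (s + 0))}.
  apply: derivable_within_continuous => x; rewrite in_itv/= => /andP[x0 _].
  by have [] := dth x (lt_le_trans (ltrN10 R) x0).
have [x _] := MVT_segment (ltW d0) D0 W0.
by rewrite pF !addr0 !add0r subrr mul0r [4 + d]addrC; lra.
Qed.

End BoundaryIntegral.

(** * Orthonormality of the Fourier modes *)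

Section Modes.
Variable R : realType.
Notation mu := (bdry_measure R).
Notation C := R[i].
Notation H := (L2 R).

Definition cis (t : R) : C := Complex (cos t) (sin t).

Lemma cisD s t : cis (s + t) = cis s * cis t.
Proof. by apply: complex_eqP; rewrite !cpartE/= (cosD, sinD)//; ring. Qed.

Lemma cisN t : cis (- t) = (cis t)^*%C.
Proof. by apply: complex_eqP; rewrite !cpartE/= (cosN, sinN). Qed.

Lemma cis0 : cis 0 = 1.
Proof. by apply: complex_eqP; rewrite /= (cos0, sin0). Qed.

Lemma cisJK t : (cis t)^*%C * cis t = 1.
Proof. by rewrite -cisN -cisD addNr cis0. Qed.

Lemma cis_2pi (k : int) : cis (2 * pi * k%:~R) = 1.
Proof.
have cisn n : cis (2 * pi * n%:R) = 1.
  elim: n => [|n ih]; first by rewrite mulr0 cis0.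
  rewrite -[n.+1]addn1 natrD mulrDr cisD ih mul1r mulr1 mulrC mulr_natr.
  by apply: complex_eqP; rewrite /= (cos2pi, sin2pi).
case: k => n; first exact: cisn.
rewrite NegzE mulrNz mulrN cisN.
by have := cisn n.+1; rewrite pmulrn => ->; apply: complex_eqP; rewrite !cpartE //= oppr0.
Qed.

Lemma frequencyD j k : frequency R (j + k) = frequency R j + frequency R k.
Proof. by rewrite /frequency intrD mulrDr mulrDl. Qed.

Lemma frequencyN k : frequency R (- k) = - frequency R k.
Proof. by rewrite /frequency mulrNz mulrN mulNr. Qed.

Lemma frequency_perimeter k : frequency R k * 4 = 2 * pi * k%:~R.
Proof. by rewrite /frequency /perimeter mulfVK// pnatr_eq0. Qed.

Definition mode_scale : R := (Num.sqrt (perimeter R))^-1.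

Lemma mode_scale_sqr : mode_scale ^+ 2 = 4^-1.
Proof. by rewrite exprVn sqr_sqrtr// /perimeter. Qed.

Lemma fourier_modeE k x :
  fourier_mode k x = mode_scale%:C%C * cis (frequency R k * x).
Proof. by []. Qed.

Lemma cis_mode_periodic k (x : R) :
  cis (frequency R k * (x + 4)) = cis (frequency R k * x).
Proof. by rewrite mulrDr cisD frequency_perimeter cis_2pi mulr1. Qed.

Lemma continuous_cos_scale (a : R) : continuous (fun x : R => cos (a * x)).
Proof.
move=> x; apply: (@continuous_comp _ _ _ (fun x => a * x) (@cos R)); last exact: continuous_cos.
exact: mulrl_continuous.
Qed.

Lemma continuous_sin_scale (a : R) : continuous (fun x : R => sin (a * x)).
Proof.
move=> x; apply: (@continuous_comp _ _ _ (fun x => a * x) (@sin R)); last exact: continuous_sin.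
exact: mulrl_continuous.
Qed.

(* A nonconstant mode changes sign under the shift by half of its wavelength,
   so its integral vanishes by translation invariance. *)
Lemma cintegral_cis (k : int) :
  cintegral (fun x => cis (frequency R k * x)) = (if k == 0 then 4 else 0 : R)%:C%C.
Proof.
have [->|k0] := eqVneq k 0.
  apply: complex_eqP => /=.
    under eq_Rintegral do rewrite /frequency mulr0 mul0r mul0r cos0.
    by rewrite Rintegral_cst// bdry_measure_setT/= mul1r.
  under eq_Rintegral do rewrite /frequency mulr0 mul0r mul0r sin0.
  by rewrite Rintegral_cst// mul0r.
(* Negating k conjugates the mode: the cosine integral is unchanged and the sine integral changes
   sign, so both vanish together for k and -k. *)
wlog kpos : k k0 / 0 < k.
  move=> W; have [/W->//|] := ltP 0 k.
  rewrite le_eqVlt (negPf k0)/= => kneg.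
  have := W (- k); rewrite oppr_eq0 oppr_gt0 => /(_ k0 kneg).
  rewrite frequencyN /cintegral => -[E1 E2]; apply: complex_eqP => /=.
    rewrite -[RHS]E1; apply: eq_Rintegral => x _ /=; by rewrite mulNr cosN.
  have bi : mu.-integrable setT (EFin \o (fun x => sin (frequency R k * x))).
    apply: (@bdry_integrable_bounded _ _ 1) => [|x]; last exact: sin_max.
    by apply: continuous_measurable_fun; exact: continuous_sin_scale.
  apply/eqP; rewrite -oppr_eq0 -mulN1r -RintegralZl//.
  by rewrite -[X in _ == X]E2; apply/eqP/eq_Rintegral => x _ /=; rewrite mulN1r mulNr sinN.
have fpos : 0 < frequency R k.
  by rewrite /frequency /perimeter divr_gt0// mulr_gt0 ?mulr_gt0 ?pi_gt0// ltr0z.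
pose d : R := pi / frequency R k.
have d0 : 0 < d by rewrite divr_gt0 ?pi_gt0.
have fd x : frequency R k * (x + d) = frequency R k * x + pi.
  by rewrite mulrDr /d mulrCA divff ?mulr1// gt_eqF.
have sh (F : R -> R) : continuous F -> (forall x, F (x + 4) = F x) -> (forall x, `|F x| <= 1) ->
    (forall x, F (x + d) = - F x) -> \int[mu]_x F x = 0.
  move=> cF pF F1 Fd; have := periodic_integral_shift cF pF F1 d0.
  have Fi : mu.-integrable setT (EFin \o F).
    by apply: (@bdry_integrable_bounded _ _ 1) => //; exact: continuous_measurable_fun.
  under eq_Rintegral do rewrite Fd -mulN1r.
  by rewrite RintegralZl// mulN1r; lra.
apply: complex_eqP => /=.
- apply: sh => [|x|x|x]; [exact: continuous_cos_scale| |exact: cos_max|].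
  + by have /(congr1 (@Re R)) := cis_mode_periodic k x.
  + by rewrite fd cosDpi.
- apply: sh => [|x|x|x]; [exact: continuous_sin_scale| |exact: sin_max|].
  + by have /(congr1 (@Im R)) := cis_mode_periodic k x.
  + by rewrite fd sinDpi.
Qed.

Lemma Lfun2_sqr_lty (f : R -> R) : measurable_fun setT f ->
  (\int[mu]_x (f x ^+ 2)%:E < +oo)%E -> f \in Lfun mu 2%:E.
Proof.
move=> mf fi; rewrite inE; apply/andP; split; rewrite inE//=.
rewrite /finite_norm (@lty_poweRy _ _ 2)// powR_Lnorm//.
apply: le_lt_trans fi; rewrite le_eqVlt; apply/orP; left; apply/eqP.
apply: eq_integral => x _.
by rewrite [LHS]poweR_EFin powR_mulrn// real_normK// num_real.
Qed.

Lemma Lfun2_le (f g : R -> R) : measurable_fun setT f ->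
  (forall x, `|f x| <= `|g x|) -> g \in Lfun mu 2%:E -> f \in Lfun mu 2%:E.
Proof.
move=> mf fg gL; apply: Lfun2_sqr_lty => //.
have /Lfun2_integrable_sqr/integrableP[mg2 gi] := gL.
apply: le_lt_trans gi; apply: ge0_le_integral => //.
- by move=> x _; rewrite lee_fin sqr_ge0.
- by apply/measurable_EFinP; exact: measurable_funX.
- exact: measurableT_comp.
- move=> x _ /=; rewrite lee_fin ger0_norm ?sqr_ge0//.
  by rewrite -real_normK ?num_real// -[leRHS]real_normK ?num_real// lerXn2r// nnegrE.
Qed.

Lemma Lfun2_bounded (f : R -> R) M : measurable_fun setT f ->
  (forall x, `|f x| <= M) -> f \in Lfun mu 2%:E.
Proof.
move=> mf fM; apply: Lfun2_sqr_lty => //.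
have /integrableP[_] : mu.-integrable setT (EFin \o (fun x => f x ^+ 2)).
  apply: (@bdry_integrable_bounded _ _ (M ^+ 2)) => [|x].
    exact: measurable_funX.
  by rewrite normrX lerXn2r// nnegrE// (le_trans _ (fM x)).
by under eq_integral => x _ do rewrite /= ger0_norm ?sqr_ge0//.
Qed.

Lemma sqi_bounded (f : R -> C) M :
  measurable_fun setT (fun x => Re (f x)) -> measurable_fun setT (fun x => Im (f x)) ->
  (forall x, `|Re (f x)| <= M /\ `|Im (f x)| <= M) -> sqi f.
Proof.
move=> mr mi fM; apply/sqi_parts; split.
  by apply: (@Lfun2_bounded _ M) => // x; have [] := fM x.
by apply: (@Lfun2_bounded _ M) => // x; have [] := fM x.
Qed.

Lemma sqi_cis a : sqi (fun x => cis (a * x)).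
Proof.
apply: (@sqi_bounded _ 1) => [| |x]; last by split; [exact: cos_max|exact: sin_max].
- by apply: continuous_measurable_fun; exact: continuous_cos_scale.
- by apply: continuous_measurable_fun; exact: continuous_sin_scale.
Qed.

Lemma sqi_mode k : sqi (@fourier_mode R k).
Proof. exact: sqiZ (sqi_cis _). Qed.

Definition modeL2 (k : int) : H := L2_of (fourier_mode k).

Lemma fourier_coefE (f : H) k : fourier_coef f k = inner (modeL2 k) f.
Proof.
rewrite -[in RHS](L2_of_repr f) inner_L2_of//; [exact: sqi_mode|exact: sqi_repr].
Qed.

Lemma inner_modeL2 j k : inner (modeL2 j) (modeL2 k) = (j == k)%:R.
Proof.
rewrite inner_L2_of; try exact: sqi_mode.
have E x : (fourier_mode j x)^*%C * fourier_mode k x =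
    (4^-1)%:C%C * cis (frequency R (k - j) * x).
  rewrite !fourier_modeE frequencyD frequencyN mulrDl mulNr cisD cisN.
  by rewrite -mode_scale_sqr; apply: complex_eqP; rewrite !cpartE/=; ring.
under [X in cintegral X]eq_fun do rewrite E.
(* [s1] concerns the constant 1, written [cis (0 * x)]; its product with the mode gives the
   integrability required below. *)
have sc := sqi_cis (frequency R (k - j)); have s1 := sqi_cis 0.
rewrite cintegralZ; last first.
  have := sqi_mul s1 sc; congr cintegrable; apply/funext => x.
  by rewrite mul0r cis0; apply: complex_eqP; rewrite !cpartE/=; ring.
rewrite cintegral_cis subr_eq0 eq_sym; case: eqP => _.
  by apply: complex_eqP; rewrite !cpartE/=; field.
by rewrite mulr0.
Qed.

End Modes.

(** * Bessel's inequality and Sobolev bounds *)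

Section Hilbert.
Variable R : realType.
Notation C := R[i].
Notation H := (L2 R).
Implicit Types (f g : H) (s : seq int) (a z : C) (k : int).

Lemma innerDl f g h : inner (f + g) h = inner f h + inner g h.
Proof. by rewrite innerC innerDr [inner f h]innerC [inner g h]innerC rmorphD. Qed.

Lemma innerZl a f g : inner (a *: f) g = a^*%C * inner f g.
Proof. by rewrite innerC innerZr [inner f g]innerC rmorphM. Qed.

Lemma inner0r f : inner f 0 = 0.
Proof. by rewrite -(scale0r 0) innerZr mul0r. Qed.

Lemma innerNr f g : inner f (- g) = - inner f g.
Proof. by rewrite -scaleN1r innerZr mulN1r. Qed.

Lemma sqnorm0 : sqnorm (0 : H) = 0.
Proof. by rewrite sqnorm_inner inner0r. Qed.

Lemma sqnormD f g : sqnorm (f + g) = sqnorm f + sqnorm g + 2 * Re (inner f g).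
Proof.
rewrite !sqnorm_inner innerDr !innerDl [inner g f]innerC !cpartE; ring.
Qed.

Lemma sqnormZ a f : sqnorm (a *: f) = sqnormc a * sqnorm f.
Proof.
rewrite sqnorm_inner innerZr innerZl mulrA mulCJ_sqnormc inner_sqnorm.
by rewrite !cpartE /= mul0r subr0.
Qed.

Lemma sqnormN f : sqnorm (- f) = sqnorm f.
Proof. by rewrite -scaleN1r sqnormZ /sqnormc !cpartE /= sqrrN expr1n oppr0 expr0n addr0 mul1r. Qed.

Lemma sqnormD_le f g : sqnorm (f + g) <= 2 * sqnorm f + 2 * sqnorm g.
Proof.
have := sqnorm_ge0 (f - g); rewrite !sqnormD sqnormN innerNr ReN; lra.
Qed.

(** Pythagoras for |f|^2 g = z f + v with v orthogonal to f. Scaling g by |f|^2 postpones the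
    division to the last cancellation, hence the separate case where this factor is zero. *)
Lemma cauchy_schwarz f g : sqnormc (inner f g) <= sqnorm f * sqnorm g.
Proof.
have [a0|a0] := eqVneq (sqnorm f) 0.
  rewrite (sqnorm_eq0 a0) innerC inner0r sqnorm0 mul0r.
  by rewrite /sqnormc !cpartE /= oppr0 !expr0n addr0.
have apos : 0 < sqnorm f by rewrite lt_def a0 sqnorm_ge0.
set z := inner f g; pose v := (sqnorm f)%:C%C *: g - z *: f.
have fv : inner (z *: f) v = 0.
  by rewrite innerZl /v innerDr innerNr !innerZr inner_sqnorm [_ * z]mulrC subrr mulr0.
have : sqnorm ((sqnorm f)%:C%C *: g) = sqnorm (z *: f) + sqnorm v.
  have -> : (sqnorm f)%:C%C *: g = z *: f + v by rewrite addrC subrK.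
  by rewrite sqnormD fv /= mulr0 addr0.
rewrite !sqnormZ {1}/sqnormc /= expr0n addr0 => E.
have := sqnorm_ge0 v => v0.
by rewrite -(ler_pM2l apos); nra.
Qed.

Lemma fourier_coefD f g k :
  fourier_coef (f + g) k = fourier_coef f k + fourier_coef g k.
Proof. by rewrite !fourier_coefE innerDr. Qed.

Lemma fourier_coefZ a f k : fourier_coef (a *: f) k = a * fourier_coef f k.
Proof. by rewrite !fourier_coefE innerZr. Qed.

Lemma fourier_coefN f k : fourier_coef (- f) k = - fourier_coef f k.
Proof. by rewrite !fourier_coefE innerNr. Qed.

(** The list stands for a finite set of frequencies in any order. Without duplicates, the subtracted
    sum is the orthogonal projection onto the span of these modes. *)
Definition residual s f : H := f - \sum_(k <- s) fourier_coef f k *: modeL2 R k.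

Lemma residual_cons k s f :
  residual (k :: s) f = residual s f - fourier_coef f k *: modeL2 R k.
Proof. by rewrite /residual big_cons opprD addrCA addrC. Qed.

Lemma residualD s f g : residual s (f + g) = residual s f + residual s g.
Proof.
rewrite /residual addrACA -opprD -big_split /=; congr (_ - _).
by apply: eq_bigr => k _; rewrite fourier_coefD scalerDl.
Qed.

Lemma residualZ s a f : residual s (a *: f) = a *: residual s f.
Proof.
rewrite /residual scalerBr scaler_sumr; congr (_ - _).
by apply: eq_bigr => k _; rewrite fourier_coefZ scalerA.
Qed.

Lemma fourier_coef_residual s f k : uniq s ->
  fourier_coef (residual s f) k = if k \in s then 0 else fourier_coef f k.
Proof.
elim: s => [|j s ih] /=; first by rewrite /residual big_nil subr0.
move=> /andP[js us]; rewrite residual_cons fourier_coefD fourier_coefN.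
rewrite fourier_coefZ (fourier_coefE (modeL2 R j)) inner_modeL2 ih// in_cons.
have [->|_] := eqVneq k j; first by rewrite (negPf js) mulr1 subrr.
by rewrite mulr0 subr0.
Qed.

Lemma sqnorm_modeL2 k : sqnorm (modeL2 R k) = 1.
Proof. by rewrite sqnorm_inner inner_modeL2 eqxx. Qed.

(** Pythagoras, one mode at a time: at a frequency outside [s] the residual still has the
    coefficient of [f]. *)
Lemma sqnorm_residual s f : uniq s ->
  sqnorm f = sqnorm (residual s f) + \sum_(k <- s) sqnormc (fourier_coef f k).
Proof.
elim: s => [|j s ih] /=; first by rewrite /residual !big_nil subr0 addr0.
move=> /andP[js us]; rewrite big_cons [LHS]ih// residual_cons sqnormD sqnormN sqnormZ.
rewrite sqnorm_modeL2 innerNr innerZr innerC -fourier_coefE fourier_coef_residual//.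
rewrite (negPf js) mulCJ_sqnormc ReN /=; ring.
Qed.

Lemma bessel s f : uniq s ->
  \sum_(k <- s) sqnormc (fourier_coef f k) <= sqnorm f.
Proof. by move=> us; rewrite (sqnorm_residual f us) lerDr sqnorm_ge0. Qed.

Lemma sqnorm_residual_le s f : uniq s -> sqnorm (residual s f) <= sqnorm f.
Proof.
move=> us; rewrite (sqnorm_residual f us) lerDl sumr_ge0// => k _.
exact: sqnormc_ge0.
Qed.

Lemma ler_sum_uniq_subset (s t : seq int) (F : int -> R) :
  uniq s -> uniq t -> {subset s <= t} -> (forall k, 0 <= F k) ->
  \sum_(k <- s) F k <= \sum_(k <- t) F k.
Proof.
move=> us ut st F0; have /permPl E := perm_filterC (mem s) t.
rewrite -(perm_big _ E) big_cat /=.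
have -> : \sum_(k <- s) F k = \sum_(k <- [seq x <- t | x \in s]) F k.
  apply: perm_big; apply: uniq_perm => //; first exact: filter_uniq.
  by move=> k; rewrite mem_filter; case: (boolP (k \in s)) => //= /st ->.
by rewrite lerDl sumr_ge0.
Qed.

Lemma residual_subset s t f : uniq s -> uniq t -> {subset s <= t} ->
  sqnorm (residual t f) <= sqnorm (residual s f).
Proof.
move=> us ut st; have := sqnorm_residual f us; rewrite (sqnorm_residual f ut).
have := ler_sum_uniq_subset us ut st (fun k => sqnormc_ge0 (fourier_coef f k)); lra.
Qed.

(** Membership in the closed span of the modes, measured by the residual: the approximant is then
    always the partial Fourier sum of [f] itself, which is what turns Bessel's inequality into
    Parseval's. *)
Definition trig_approximable f : Prop :=
  forall e : R, 0 < e -> exists2 s, uniq s & sqnorm (residual s f) <= e.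

Lemma trig_approximable_mode k : trig_approximable (modeL2 R k).
Proof.
move=> e e0; exists [:: k] => //; rewrite /residual big_seq1.
by rewrite fourier_coefE inner_modeL2 eqxx scale1r subrr sqnorm0 ltW.
Qed.

Lemma trig_approximableD f g :
  trig_approximable f -> trig_approximable g -> trig_approximable (f + g).
Proof.
move=> af ag e e0; have e4 : 0 < e / 4 by rewrite divr_gt0.
have [s us sf] := af _ e4; have [t ut tg] := ag _ e4.
have uu : uniq (undup (s ++ t)) by exact: undup_uniq.
exists (undup (s ++ t)) => //; rewrite residualD.
apply: (le_trans (sqnormD_le _ _)).
have -> : e = 2 * (e / 4) + 2 * (e / 4) by field.
rewrite lerD// ler_wpM2l//; [apply: le_trans sf|apply: le_trans tg];
  apply: residual_subset => // x xs; by rewrite mem_undup mem_cat xs ?orbT.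
Qed.

Lemma trig_approximableZ a f : trig_approximable f -> trig_approximable (a *: f).
Proof.
move=> af e e0; have a1 : 0 < sqnormc a + 1 by rewrite ltr_wpDl ?sqnormc_ge0.
have [s us sf] := af (e / (sqnormc a + 1)) (divr_gt0 e0 a1).
exists s => //; rewrite residualZ sqnormZ.
apply: (@le_trans _ _ ((sqnormc a + 1) * (e / (sqnormc a + 1)))).
  apply: ler_pM => //; [exact: sqnormc_ge0|exact: sqnorm_ge0|by rewrite lerDl].
by rewrite mulrCA divff ?mulr1// gt_eqF.
Qed.

(** Taking residuals is linear and does not increase the L^2 norm, so the residual of [f] is that of
    [g] up to an error no larger than [f - g]. *)
Lemma trig_approximable_closed f :
  (forall e : R, 0 < e -> exists2 g, trig_approximable g & sqnorm (f - g) <= e) ->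
  trig_approximable f.
Proof.
move=> fg e e0; have e4 : 0 < e / 4 by rewrite divr_gt0.
have [g ag gf] := fg _ e4; have [s us sg] := ag _ e4.
exists s => //; rewrite -[f](subrK g) residualD.
apply: (le_trans (sqnormD_le _ _)).
have -> : e = 2 * (e / 4) + 2 * (e / 4) by field.
by rewrite lerD// ler_wpM2l// (le_trans _ gf)//; exact: sqnorm_residual_le.
Qed.

(** * The H^{1/2} norm through finite weighted sums *)

Definition sobolev_weight k : R := (1 + frequency R k ^+ 2) `^ 2^-1.

Lemma sobolev_weight_ge1 k : 1 <= sobolev_weight k.
Proof.
have h : 1 <= 1 + frequency R k ^+ 2 by rewrite lerDl sqr_ge0.
have E : 1 = 1 `^ 2^-1 :> R by rewrite powR1.
by rewrite [leLHS]E /sobolev_weight ge0_ler_powR ?invr_ge0// nnegrE; lra.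
Qed.

(** The weight of H^1 dominates that of H^{1/2}, and squared frequencies can be read off from
    translates. *)
Lemma sobolev_weight_le k : sobolev_weight k <= 1 + frequency R k ^+ 2.
Proof.
have h : 1 <= 1 + frequency R k ^+ 2 by rewrite lerDl sqr_ge0.
rewrite -[leRHS]powRr1; last lra.
by apply: ler_powR => //; lra.
Qed.

Lemma sobolev_weight_ge0 k : 0 <= sobolev_weight k.
Proof. exact: le_trans ler01 (sobolev_weight_ge1 k). Qed.

Definition sobolev_term f k : R := sobolev_weight k * sqnormc (fourier_coef f k).

Lemma sobolev_term_ge0 f k : 0 <= sobolev_term f k.
Proof. by rewrite mulr_ge0 ?sqnormc_ge0 ?sobolev_weight_ge0. Qed.

(** [B] bounds the square of the norm; the link with [H12_norm] is [H12_norm_leP]. *)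
Definition sobolev_le f (B : R) : Prop :=
  forall s, uniq s -> \sum_(k <- s) sobolev_term f k <= B.

Lemma sobolev_le_ge0 f B : sobolev_le f B -> 0 <= B.
Proof. by move/(_ [::] isT); rewrite big_nil. Qed.

Lemma sobolev_leW f B B' : B <= B' -> sobolev_le f B -> sobolev_le f B'.
Proof. by move=> BB fB s us; exact: le_trans (fB s us) BB. Qed.

Lemma sobolev_leD f g B B' : sobolev_le f B -> sobolev_le g B' ->
  sobolev_le (f + g) (2 * B + 2 * B').
Proof.
move=> fB gB s us; apply: (@le_trans _ _ (2 * \sum_(k <- s) sobolev_term f k + 2 * \sum_(k <- s) sobolev_term g k)).
  rewrite !mulr_sumr -big_split /=; apply: ler_sum => k _.
  rewrite /sobolev_term fourier_coefD.
  rewrite mulrCA [X in _ <= _ + X]mulrCA -mulrDr.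
  by apply: ler_wpM2l; [exact: sobolev_weight_ge0|exact: sqnormcD].
by rewrite lerD// ler_wpM2l//; [exact: fB|exact: gB].
Qed.

Lemma sobolev_leZ a f B : sobolev_le f B -> sobolev_le (a *: f) (sqnormc a * B).
Proof.
move=> fB s us; apply: le_trans (ler_wpM2l (sqnormc_ge0 a) (fB s us)).
rewrite mulr_sumr; apply: ler_sum => k _.
by rewrite /sobolev_term fourier_coefZ sqnormcM mulrCA.
Qed.

Lemma sobolev_leN f B : sobolev_le f B -> sobolev_le (- f) B.
Proof.
move=> /(@sobolev_leZ (-1)); rewrite scaleN1r.
by rewrite /sqnormc !cpartE /= sqrrN expr1n oppr0 expr0n addr0 mul1r.
Qed.

(** The list is chosen within [e] of the supremum of all finite sums, so a finite sum over
    frequencies outside it cannot exceed [e]. *)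
Lemma sobolev_residual f B e : sobolev_le f B -> 0 < e ->
  exists2 s, uniq s & sobolev_le (residual s f) e.
Proof.
move=> fB e0; pose S := [set x | exists2 s, uniq s & x = \sum_(k <- s) sobolev_term f k].
have hS : has_sup S.
  split; first by exists 0; exists [::] => //; rewrite big_nil.
  by exists B => _ [s us ->]; exact: fB.
have [_ [s us ->] xs] := sup_adherent e0 hS.
exists s => // t ut.
have -> : \sum_(k <- t) sobolev_term (residual s f) k =
    \sum_(k <- [seq k <- t | k \notin s]) sobolev_term f k.
  rewrite big_filter [LHS]big_mkcond [RHS]big_mkcond; apply: eq_bigr => k _ /=.
  rewrite /sobolev_term fourier_coef_residual//; case: ifP => //= _.
  by rewrite /sqnormc /= expr0n addr0 mulr0.
have : \sum_(k <- s ++ [seq k <- t | k \notin s]) sobolev_term f k <= sup S.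
  apply: ub_le_sup; first by case: hS.
  exists (s ++ [seq k <- t | k \notin s]) => //.
  rewrite cat_uniq us filter_uniq//= andbT; apply/hasPn => k.
  by rewrite mem_filter => /andP[].
rewrite big_cat /=; lra.
Qed.

(** The weights are at least 1, so the sum of squared coefficients is at most [B]; approximability
    makes the remaining residual arbitrarily small. *)
Lemma sqnorm_le_sobolev f B :
  trig_approximable f -> sobolev_le f B -> sqnorm f <= B.
Proof.
move=> af fB; apply/ler_addgt0Pl => e e0; have [s us sf] := af e e0.
rewrite (sqnorm_residual f us) lerD//; apply: le_trans (fB s us).
apply: ler_sum => k _; rewrite ler_peMl ?sqnormc_ge0//.
exact: sobolev_weight_ge1.
Qed.

End Hilbert.

(** * Lipschitz functions *)

Section Lipschitz.
Variable R : realType.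
Notation mu := (bdry_measure R).
Notation C := R[i].
Notation H := (L2 R).

Definition lipschitz_fun (L : R) (u : R -> R) : Prop :=
  forall x y, `|u x - u y| <= L * `|x - y|.

Lemma lipschitz_fun_continuous L u : lipschitz_fun L u -> continuous u.
Proof.
move=> uL x; apply/cvgrPdist_lt => e e0; near=> y.
have L1 : 0 < `|L| + 1 by rewrite ltr_wpDl.
apply: (le_lt_trans (uL x y)); apply: (@le_lt_trans _ _ ((`|L| + 1) * `|x - y|)).
  by rewrite ler_wpM2r// (le_trans (ler_norm L))// lerDl.
rewrite mulrC -ltr_pdivlMr//; near: y.
by apply: cvgr_dist_lt => //; rewrite divr_gt0.
Unshelve. all: by end_near. Qed.

Lemma deriv_lipschitz (u du : R -> R) L : (forall x : R, is_derive x (1 : R) u (du x)) ->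
  (forall x, `|du x| <= L) -> lipschitz_fun L u.
Proof.
move=> Du duL x y; wlog xy : x y / x <= y.
  by move=> W; have [/W//|/ltW/W] := leP x y; rewrite distrC [`|y - x|]distrC.
have cu : {within `[x, y], continuous u}.
  apply: continuous_subspaceT => z; apply: differentiable_continuous.
  by apply/derivable1_diffP; have [] := Du z.
have [z _ E] := MVT_segment xy (fun z _ => Du z) cu.
by rewrite distrC E normrM [`|x - y|]distrC ler_wpM2r.
Qed.

(** The factor 8 is the perimeter 4 times the 2 coming from the real and imaginary parts. *)
Lemma sqnorm_bounded (g : R -> C) B : sqi g ->
  (forall x, `|Re (g x)| <= B /\ `|Im (g x)| <= B) ->
  sqnorm (L2_of g) <= 8 * B ^+ 2.
Proof.
move=> sg gB; rewrite sqnorm_inner inner_L2_of//=.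
have [rg _] := sqi_mul sg sg.
apply: (@le_trans _ _ (\int[mu]_x (2 * B ^+ 2))).
  apply: le_Rintegral => //.
    apply: (@bdry_integrable_bounded _ _ (2 * B ^+ 2)) => // x.
    by rewrite ger0_norm// mulr_ge0// sqr_ge0.
  move=> x _; have [g1 g2] := gB x; rewrite !cpartE.
  have B0 : 0 <= B by exact: le_trans g1.
  move: g1 g2; rewrite -(ler_sqr (normr_ge0 _))// -[in X in _ -> X -> _](ler_sqr (normr_ge0 _))//.
  by rewrite ?nnegrE// !real_normK ?num_real//; nra.
by rewrite Rintegral_cst// bdry_measure_setT/=; lra.
Qed.

Lemma periodic_cintegral_shift (F : R -> C) (M d : R) :
  continuous (fun x => Re (F x)) -> continuous (fun x => Im (F x)) ->
  (forall x, F (x + 4) = F x) ->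
  (forall x, `|Re (F x)| <= M /\ `|Im (F x)| <= M) -> 0 < d ->
  cintegral (fun x => F (x + d)) = cintegral F.
Proof.
move=> cr ci pF FM d0; apply: complex_eqP => /=.
  apply: (@periodic_integral_shift _ (fun x => Re (F x)) M) => // x; first by rewrite pF.
  by have [] := FM x.
apply: (@periodic_integral_shift _ (fun x => Im (F x)) M) => // x; first by rewrite pF.
by have [] := FM x.
Qed.

Lemma is_derive_cos_scale (a b x : R) :
  is_derive x 1 (fun x => b * cos (a * x)) (- (b * a) * sin (a * x)).
Proof.
have D1 : is_derive x 1 (fun x : R => a * x) a.
  have := @is_deriveZ _ _ _ (@id R) a x 1 1 (is_derive_id x 1).
  by rewrite scaler1; apply.
have D2 := @is_derive1_comp _ (@cos R) (fun x => a * x) x _ _ (is_derive_cos _) D1.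
have := @is_deriveZ _ _ _ _ b x 1 _ D2.
have -> : - (b * a) * sin (a * x) = b *: (- sin (a * x) * a) by rewrite -[RHS]/(b * _); ring.
exact.
Qed.

Lemma is_derive_sin_scale (a b x : R) :
  is_derive x 1 (fun x => b * sin (a * x)) (b * a * cos (a * x)).
Proof.
have D1 : is_derive x 1 (fun x : R => a * x) a.
  have := @is_deriveZ _ _ _ (@id R) a x 1 1 (is_derive_id x 1).
  by rewrite scaler1; apply.
have D2 := @is_derive1_comp _ (@sin R) (fun x => a * x) x _ _ (is_derive_sin _) D1.
have := @is_deriveZ _ _ _ _ b x 1 _ D2.
have -> : b * a * cos (a * x) = b *: (cos (a * x) * a) by rewrite -[RHS]/(b * _); ring.
exact.
Qed.

(** On a neighbourhood of 0 where the cosine exceeds 1/2, the mean value theorem gives |sin t| >=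
    |t| / 2, and sin t is the imaginary part of [cis t - 1]. This turns a bound on translates back
    into a bound on frequencies. *)
Lemma sqnormc_cisB1_ge : exists2 r : R, 0 < r &
  forall t : R, `|t| < r -> t ^+ 2 <= 4 * sqnormc (cis t - 1).
Proof.
have c0 : (cos : R -> R) x @[x --> (0 : R)] --> (1 : R).
  by rewrite -cos0; exact: continuous_cos.
have [r /= r0 rcos] : \forall t \near (0 : R), 2^-1 < cos t.
  by have := cvgr_gt 1 c0; apply; lra.
exists r => // t tr.
suff : (t / 2) ^+ 2 <= sin t ^+ 2.
  rewrite /sqnormc !cpartE /= => h; have := sqr_ge0 (cos t - 1); nra.
have pos (s : R) : 0 <= s -> s < r -> (s / 2) ^+ 2 <= sin s ^+ 2.
  move=> s0 sr; have cs : {within `[0, s], continuous (@sin R)}.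
    by apply: continuous_subspaceT; exact: continuous_sin.
  have [z + E] := MVT_segment s0 (fun z _ => is_derive_sin z) cs.
  rewrite in_itv/= => /andP[z0 zs].
  have cz : 2^-1 < cos z.
    by apply: rcos; rewrite /= sub0r normrN ger0_norm//; exact: le_lt_trans sr.
  move: E; rewrite sin0 !subr0 => ->.
  by rewrite ler_sqr ?nnegrE; nra.
have [t0|t0] := leP 0 t; first by apply: pos => //; rewrite -(ger0_norm t0).
have := pos (- t); rewrite sinN mulNr !sqrrN; apply; first lra.
by rewrite -(ltr0_norm t0).
Qed.

(** * Sobolev bound for periodic Lipschitz functions *)

Section Translate.
Variables (g : R -> C) (B L : R).
Hypothesis gB : forall x, `|Re (g x)| <= B /\ `|Im (g x)| <= B.
Hypothesis gr : lipschitz_fun L (fun x => Re (g x)).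
Hypothesis gi : lipschitz_fun L (fun x => Im (g x)).
Hypothesis pg : forall x, g (x + 4) = g x.

Let cr := lipschitz_fun_continuous gr.
Let ci := lipschitz_fun_continuous gi.

Lemma sqi_lipschitz : sqi g.
Proof.
by apply: (@sqi_bounded _ _ B) => //; exact: continuous_measurable_fun.
Qed.

Lemma continuous_shift (u : R -> R) d : continuous u -> continuous (fun x => u (x + d)).
Proof.
move=> cu x; apply: (@continuous_comp _ _ _ (fun x => x + d) u); last exact: cu.
by apply: continuousD; [exact: cvg_id|exact: cvg_cst].
Qed.

Lemma sqi_shift d : sqi (fun x => g (x + d)).
Proof.
apply: (@sqi_bounded _ _ B) => [| |x]; last exact: gB.
- by apply: continuous_measurable_fun; exact: (@continuous_shift (fun x => Re (g x))).
- by apply: continuous_measurable_fun; exact: (@continuous_shift (fun x => Im (g x))).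
Qed.

Lemma fourier_coef_shift d k : 0 < d ->
  fourier_coef (L2_of (fun x => g (x + d))) k =
  cis (frequency R k * d) * fourier_coef (L2_of g) k.
Proof.
move=> d0; rewrite !fourier_coefE !inner_L2_of; try exact: sqi_mode; try exact: sqi_shift;
  try exact: sqi_lipschitz.
pose F x := (fourier_mode k x)^*%C * g x.
pose w := mode_scale R; have w0 : 0 <= w by rewrite invr_ge0 sqrtr_ge0.
(* Both the real and the imaginary part of [F] have this shape, so continuity and boundedness are
   proved once. *)
pose T (u v : R -> R) x := w * cos (frequency R k * x) * u x + w * sin (frequency R k * x) * v x.
have ReF : (fun x => Re (F x)) = T (fun x => Re (g x)) (fun x => Im (g x)).
  by apply/funext => x; rewrite /F fourier_modeE !cpartE /= /T /w; ring.
have ImF : (fun x => Im (F x)) = T (fun x => Im (g x)) (fun x => - Re (g x)).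
  by apply/funext => x; rewrite /F fourier_modeE !cpartE /= /T /w; ring.
have cT u v : continuous u -> continuous v -> continuous (T u v).
  move=> cu cv x; rewrite /T; apply: cvgD; apply: cvgM; try exact: cu; try exact: cv.
    by apply: cvgM; [exact: cvg_cst|exact: continuous_cos_scale].
  by apply: cvgM; [exact: cvg_cst|exact: continuous_sin_scale].
have TB (u v : R -> R) x : `|u x| <= B -> `|v x| <= B -> `|T u v x| <= w * (2 * B).
  move=> uB vB; rewrite /T -!mulrA -mulrDr normrM ger0_norm//.
  apply: ler_wpM2l => //.
  apply: (le_trans (ler_normD _ _)); rewrite !normrM (_ : 2 * B = 1 * B + 1 * B); last ring.
  by rewrite lerD// ler_pM// ?cos_max ?sin_max.
have <- : cintegral (fun x => F (x + d)) = cintegral F.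
  apply: (@periodic_cintegral_shift _ (w * (2 * B))) => // [||x|x].
  - by rewrite ReF; exact: cT.
  - by rewrite ImF; apply: cT => // x; apply: continuousN; exact: cr.
  - by rewrite /F pg !fourier_modeE cis_mode_periodic.
  - have [g1 g2] := gB x; split; first by rewrite -[Re _]/((fun x => Re (F x)) x) ReF TB.
    by rewrite -[Im _]/((fun x => Im (F x)) x) ImF TB// normrN.
have -> : (fun x => F (x + d)) =
    (fun x => (cis (frequency R k * d))^*%C * ((fourier_mode k x)^*%C * g (x + d))).
  apply/funext => x; rewrite /F !fourier_modeE mulrDr cisD !rmorphM.
  by move: (cis (_ * x)) (cis (_ * d)) => a b; ring.
rewrite cintegralZ; last exact: sqi_mul (sqi_mode _ k) (sqi_shift d).
by rewrite mulrA [cis _ * _]mulrC cisJK mul1r.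
Qed.

(* Bessel's inequality for the translates (g(. + d) - g) / d bounds the sum of
   nu_k^2 |c_k|^2 without differentiating g. *)
Lemma sobolev_le_lipschitz : sobolev_le (L2_of g) (8 * B ^+ 2 + 32 * L ^+ 2).
Proof.
move=> s us; have sg := sqi_lipschitz.
have [r r0 rc] := sqnormc_cisB1_ge.
(* [M] exceeds every |nu_k| with k in [s], so the single shift [d] brings all |nu_k d| below [r]. It
   depends on [s], but cancels from the final bound. *)
pose M := \sum_(k <- s) `|frequency R k| + 1.
have M0 : 0 < M by rewrite ltr_wpDl// sumr_ge0.
pose d := r / (2 * M); have d0 : 0 < d by rewrite divr_gt0// mulr_gt0.
have fd k : k \in s -> `|frequency R k * d| < r.
  move=> ks; rewrite normrM (gtr0_norm d0).
  apply: (@le_lt_trans _ _ (M * d)).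
    rewrite ler_wpM2r ?(ltW d0)// /M (big_rem _ ks)/= -addrA lerDl addr_ge0// sumr_ge0//.
  have -> : M * d = r / 2 by rewrite /d; field; rewrite gt_eqF.
  by lra.
apply: (@le_trans _ _ (\sum_(k <- s) sqnormc (fourier_coef (L2_of g) k) +
   \sum_(k <- s) frequency R k ^+ 2 * sqnormc (fourier_coef (L2_of g) k))).
  rewrite -big_split /=; apply: ler_sum => k _; rewrite /sobolev_term.
  rewrite -[X in _ <= X + _]mul1r -mulrDl ler_wpM2r ?sqnormc_ge0//; exact: sobolev_weight_le.
rewrite lerD//; first exact: le_trans (bessel _ us) (sqnorm_bounded sg gB).
pose D := L2_of (fun x => g (x + d)) - L2_of g.
have D_of : D = L2_of (fun x => g (x + d) + (-1) * g x).
  by rewrite L2_ofD ?L2_ofZ ?scaleN1r//; [exact: sqi_shift|exact: sqiZ].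
have DB : sqnorm D <= 8 * (L * d) ^+ 2.
  rewrite D_of; apply: sqnorm_bounded; first by apply: sqiD; [exact: sqi_shift|exact: sqiZ].
  move=> x; rewrite !cpartE /= oppr0 !mul0r subr0 addr0 !mulN1r.
  have := gr (x + d) x; have := gi (x + d) x.
  by rewrite addrAC subrr add0r (gtr0_norm d0).
(* The coefficient of [D] is [cis (nu_k d) - 1] times that of [g], so the lower bound near 0
   applies. The 4 here and the 8 of the sup-norm bound give the constant 32. *)
have Dk k : k \in s -> frequency R k ^+ 2 * sqnormc (fourier_coef (L2_of g) k) <=
    4 / d ^+ 2 * sqnormc (fourier_coef D k).
  move=> ks; rewrite fourier_coefD fourier_coefN fourier_coef_shift//.
  rewrite -[X in _ - X]mul1r -mulrBl sqnormcM mulrA ler_wpM2r ?sqnormc_ge0//.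
  rewrite mulrAC ler_pdivlMr ?exprn_gt0// -exprMn; exact: rc (fd k ks).
apply: (@le_trans _ _ (4 / d ^+ 2 * \sum_(k <- s) sqnormc (fourier_coef D k))).
  rewrite mulr_sumr big_seq_cond [leRHS]big_seq_cond; apply: ler_sum => k.
  by rewrite andbT; exact: Dk.
apply: (@le_trans _ _ (4 / d ^+ 2 * (8 * (L * d) ^+ 2))).
  rewrite ler_wpM2l//; first by rewrite divr_ge0// sqr_ge0.
  exact: le_trans (bessel _ us) DB.
have E (x : R) : x != 0 -> 4 / x ^+ 2 * (8 * (L * x) ^+ 2) = 32 * L ^+ 2 by move=> ?; field.
by rewrite E// gt_eqF.
Qed.

End Translate.

End Lipschitz.

(** * Piecewise linear interpolation *)

Section Interpolation.
Variable R : realType.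
Notation C := R[i].
Notation H := (L2 R).

Section Mesh.
Variables (h x1 : R).
Hypothesis h0 : 0 < h.

(** Nodes are indexed by all integers: the mesh covers the whole line, so periodic functions need no
    wrap-around case. *)
Definition mesh_node (m : int) : R := x1 + m%:~R * h.

Definition mesh_cell (x : R) : int := Num.floor ((x - x1) / h).

Definition interp (t : R -> R) (x : R) : R :=
  t (mesh_node (mesh_cell x)) + (x - mesh_node (mesh_cell x)) / h *
    (t (mesh_node (mesh_cell x + 1)) - t (mesh_node (mesh_cell x))).

Lemma mesh_nodeD1 m : mesh_node (m + 1) = mesh_node m + h.
Proof. by rewrite /mesh_node intrD mulrDl mul1r addrA. Qed.

Lemma mesh_cellP x : mesh_node (mesh_cell x) <= x < mesh_node (mesh_cell x + 1).
Proof.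
have := floor_itv ((x - x1) / h); rewrite -/(mesh_cell x) => /andP[c1 c2].
rewrite /mesh_node -!lerBrDl -ltrBlDl; apply/andP; split.
  by rewrite -ler_pdivlMr.
by rewrite -ltr_pdivrMr.
Qed.

Lemma mesh_cell_def m x : mesh_node m <= x < mesh_node (m + 1) -> mesh_cell x = m.
Proof.
rewrite /mesh_node => /andP[c1 c2]; apply: floor_def.
by rewrite ler_pdivlMr// lerBrDl c1 /= ltr_pdivrMr// ltrBlDl.
Qed.

Lemma interp_cell t m x : mesh_node m <= x <= mesh_node (m + 1) ->
  interp t x = t (mesh_node m) + (x - mesh_node m) / h *
    (t (mesh_node (m + 1)) - t (mesh_node m)).
Proof.
(* The floor assigns the right endpoint to the next cell; the two affine pieces agree there. *)
move=> /andP[mx]; rewrite le_eqVlt => /orP[/eqP xE|xm].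
  have -> : interp t x = t (mesh_node (m + 1)).
    have cx : mesh_cell x = m + 1.
      by apply: mesh_cell_def; rewrite xE lexx [ltRHS]mesh_nodeD1 ltrDl.
    by rewrite /interp cx xE subrr mul0r mul0r addr0.
  have -> : x - mesh_node m = h by rewrite xE mesh_nodeD1 addrC addKr.
  rewrite divff ?gt_eqF// mul1r.
  by ring.
by rewrite /interp (@mesh_cell_def m) ?mx.
Qed.

(** Induction on the number of cells between the points: the segment is cut at the last node [p]
    before [y], and since x <= p <= y the two distances add up to that of x and y. *)
Lemma mesh_lipschitz L (u : R -> R) : 0 <= L ->
  (forall m x y, mesh_node m <= x <= mesh_node (m + 1) ->
     mesh_node m <= y <= mesh_node (m + 1) -> `|u x - u y| <= L * `|x - y|) ->
  lipschitz_fun L u.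
Proof.
move=> L0 ucell.
have chain (n : nat) m x y : mesh_node m <= x <= mesh_node (m + 1) -> x <= y ->
    y <= mesh_node (m + 1 + n%:Z) -> `|u x - u y| <= L * `|x - y|.
  elim: n y => [|n ih] y xm xy.
    rewrite addr0 => ym; apply: (ucell m) => //; rewrite ym andbT.
    by apply: le_trans xy; case/andP: xm.
  have [ym _|ym yn] := leP y (mesh_node (m + 1 + n%:Z)); first exact: ih.
  set p := mesh_node _ in ym.
  have xp : x <= p.
    case/andP: xm => _ /le_trans; apply.
    by rewrite /p /mesh_node lerD2l ler_wpM2r ?(ltW h0)// ler_int lerDl.
  have pn : mesh_node (m + 1 + n%:Z) <= p <= mesh_node (m + 1 + n%:Z + 1).
    by rewrite lexx mesh_nodeD1 lerDl ltW.
  have yn' : mesh_node (m + 1 + n%:Z) <= y <= mesh_node (m + 1 + n%:Z + 1).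
    by rewrite (ltW ym) /= -[X in mesh_node X]addrA -PoszD addn1.
  have h1 := ih p xm xp (lexx _); have h2 := ucell _ _ _ pn yn'.
  rewrite -(subrKA (u p)); apply: (le_trans (ler_normD _ _)).
  apply: (le_trans (lerD h1 h2)); rewrite -mulrDr ler_wpM2l//.
  rewrite !ler0_norm ?subr_le0//; [lra|exact: ltW].
move=> x y; wlog xy : x y / x <= y.
  by move=> W; have [/W//|/ltW/W] := leP x y; rewrite distrC [`|y - x|]distrC.
have cc : mesh_cell x <= mesh_cell y.
  by rewrite floor_ge_int (le_trans (floor_le _))// ler_pM2r ?invr_gt0// lerD2r.
have /andP[c1 c2] := mesh_cellP x; have /andP[d1 d2] := mesh_cellP y.
apply: (chain `|mesh_cell y - mesh_cell x|%N (mesh_cell x)) => //.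
  by rewrite c1 ltW.
rewrite gez0_abs ?subr_ge0//.
have -> : mesh_cell x + 1 + (mesh_cell y - mesh_cell x) = mesh_cell y + 1 by ring.
exact: ltW.
Qed.

Lemma interp_periodic (n : nat) t x : h * n%:R = 4 ->
  (forall x, t (x + 4) = t x) -> interp t (x + 4) = interp t x.
Proof.
move=> hn pt.
have nn m : mesh_node (m + n%:Z) = mesh_node m + 4.
  by rewrite /mesh_node intrD mulrDl -hn addrA [h * _]mulrC.
have cn : mesh_cell (x + 4) = mesh_cell x + n%:Z.
  apply: mesh_cell_def; have /andP[c1 c2] := mesh_cellP x.
  by rewrite nn lerD2r c1 addrAC nn ltrD2r.
rewrite /interp cn nn [_ + n%:Z + 1]addrAC nn !pt.
by rewrite [X in X / h](_ : _ = x - mesh_node (mesh_cell x)); last ring.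
Qed.

Section Error.
Variables (t dt : R -> R) (D : R).
Hypothesis Dt : forall x : R, is_derive x (1 : R) t (dt x).
Hypothesis D0 : 0 <= D.
Hypothesis dtD : lipschitz_fun D dt.

Let MVT_t x y : x <= y -> exists2 z, x <= z <= y & t y - t x = dt z * (y - x).
Proof.
move=> xy; have ct : {within `[x, y], continuous t}.
  apply: continuous_subspaceT => z; apply: differentiable_continuous.
  by apply/derivable1_diffP; have [] := Dt z.
by have [z zxy E] := MVT_segment xy (fun z _ => Dt z) ct; exists z => //; move: zxy; rewrite in_itv.
Qed.

(** On a cell, the slope of the chord is [dt w] at some point [w] of that cell, so an increment of
    the error is [dt w - dt z] times [y - x], with both points in an interval of length [h]. No
    second derivative is taken. *)
Lemma interp_error_lipschitz : lipschitz_fun (D * h) (fun x => t x - interp t x).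
Proof.
apply: mesh_lipschitz => [|m x y xm ym]; first by rewrite mulr_ge0// ltW.
wlog xy : x y xm ym / x <= y.
  by move=> W; have [xy|/ltW yx] := leP x y; [exact: W|rewrite distrC [`|x - y|]distrC; exact: W].
rewrite !(@interp_cell _ m)// mesh_nodeD1; move: xm ym; rewrite mesh_nodeD1.
move: (mesh_node m) => a /andP[x1' x2'] /andP[y1 y2].
have ah : a <= a + h by rewrite lerDl ltW.
have [z /andP[z1 z2] Ez] := MVT_t xy; have [w /andP[w1 w2] Ew] := MVT_t ah.
have -> : t x - (t a + (x - a) / h * (t (a + h) - t a)) -
    (t y - (t a + (y - a) / h * (t (a + h) - t a))) =
    (y - x) / h * (t (a + h) - t a) - (t y - t x) by ring.
rewrite Ez Ew (_ : (y - x) / h * _ - _ = (dt w - dt z) * (y - x)); last first.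
  by field; rewrite gt_eqF.
rewrite normrM [`|x - y|]distrC ler_wpM2r//; apply: (le_trans (dtD w z)).
by rewrite ler_wpM2l// ler_norml; apply/andP; split; lra.
Qed.

(** The error vanishes at the node to the left of [x], at distance at most [h]. *)
Lemma interp_error_bound x : `|t x - interp t x| <= D * h * h.
Proof.
have /andP[c1 c2] := mesh_cellP x.
have := interp_error_lipschitz x (mesh_node (mesh_cell x)).
set a := mesh_node (mesh_cell x).
have -> : interp t a = t a.
  rewrite (@interp_cell _ (mesh_cell x)) -/a; last by rewrite lexx mesh_nodeD1 lerDl ltW.
  by rewrite subrr mul0r mul0r addr0.
rewrite subrr subr0 => /le_trans; apply; rewrite ler_wpM2l//.
  by rewrite mulr_ge0// ltW.
by rewrite ger0_norm ?subr_ge0// lerBlDl -mesh_nodeD1 ltW.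
Qed.

End Error.

End Mesh.

Lemma continuous_complex_parts (u : R -> C^o) :
  continuous (fun x => Re (u x)) -> continuous (fun x => Im (u x)) -> continuous u.
Proof.
move=> cr ci x; apply/cvgrPdist_lt => -[e e'].
(* In the order of R[i] a positive number is real, so the radius has no imaginary part. *)
rewrite ltcE /= => /andP[/eqP -> e0].
have e2 : 0 < e / 2 by rewrite divr_gt0.
near=> y; rewrite normc_def ltcR.
have h1 : `|Re (u x) - Re (u y)| < e / 2.
  by near: y; have /cvgrPdist_lt := cr x; apply.
have h2 : `|Im (u x) - Im (u y)| < e / 2.
  by near: y; have /cvgrPdist_lt := ci x; apply.
rewrite ReD ImD ReN ImN; move: h1 h2; move: (_ - _) (_ - _) => p q h1 h2.
have -> : e = Num.sqrt (e ^+ 2) by rewrite sqrtr_sqr gtr0_norm.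
rewrite ltr_sqrt ?exprn_gt0//.
have : `|p| ^+ 2 < (e / 2) ^+ 2 by rewrite ltr_sqr ?nnegrE// ltW.
have : `|q| ^+ 2 < (e / 2) ^+ 2 by rewrite ltr_sqr ?nnegrE// ltW.
by rewrite !real_normK ?num_real//; nra.
Unshelve. all: by end_near. Qed.

Lemma interp_piecewise_linear (n : nat) (x1 : R) (t1 t2 : R -> R) :
  (0 < n)%N ->
  (forall x, t1 (x + 4) = t1 x) -> (forall x, t2 (x + 4) = t2 x) ->
  continuous (interp (4 / n%:R) x1 t1) -> continuous (interp (4 / n%:R) x1 t2) ->
  piecewise_linear n x1
    (fun x => Complex (interp (4 / n%:R) x1 t1 x) (interp (4 / n%:R) x1 t2 x) : C^o).
Proof.
move=> n0 p1 p2 c1 c2; have nR : n%:R != 0 :> R by rewrite pnatr_eq0 -lt0n.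
have h0 : 0 < 4 / n%:R :> R by rewrite divr_gt0// ltr0n.
have hn : 4 / n%:R * n%:R = 4 :> R by rewrite divfK.
split.
- exact: continuous_complex_parts.
- by move=> x; rewrite /perimeter !(@interp_periodic _ x1 h0 _ _ _ hn).
move=> j jn; set h := 4 / n%:R in h0 *.
have nodeE i : node n x1 i = mesh_node h x1 i%:Z by [].
pose sl (t : R -> R) := (t (mesh_node h x1 (j%:Z + 1)) - t (mesh_node h x1 j%:Z)) / h.
pose ic (t : R -> R) := t (mesh_node h x1 j%:Z) - mesh_node h x1 j%:Z * sl t.
exists (Complex (ic t1) (ic t2)), (Complex (sl t1) (sl t2)) => x.
rewrite in_itv /= !nodeE -[j.+1]addn1 PoszD => xj.
rewrite !(@interp_cell h x1 h0 _ j%:Z)//.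
by apply: complex_eqP; rewrite !cpartE /= /ic /sl; ring.
Qed.

Lemma mode_PL_approx (k : int) (n : nat) (x1 : R) : (0 < n)%N ->
  exists2 v : H, PL_space n x1 v &
    sobolev_le (modeL2 R k - v)
      (160 * (mode_scale R * frequency R k ^+ 2) ^+ 2 * (4 / n%:R) ^+ 2).
Proof.
move=> n0; have h0 : 0 < 4 / n%:R :> R by rewrite divr_gt0// ltr0n.
have h4 : 4 / n%:R <= 4 :> R by rewrite ler_pdivrMr ?ltr0n// ler_peMr// ler1n.
have hn : 4 / n%:R * n%:R = 4 :> R by rewrite divfK// pnatr_eq0 -lt0n.
set h := 4 / n%:R in h0 h4 hn *.
set w := mode_scale R; set nu := frequency R k.
have w0 : 0 <= w by rewrite invr_ge0 sqrtr_ge0.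
pose t1 x := w * cos (nu * x); pose t2 x := w * sin (nu * x).
(* [D] bounds the second derivatives of [t1] and [t2], that is, the Lipschitz constants of their
   first derivatives. *)
pose D := w * nu ^+ 2; have D0 : 0 <= D by rewrite mulr_ge0// sqr_ge0.
have bc (a x : R) : `|a * cos x| <= `|a| by rewrite normrM ler_piMr// cos_max.
have bs (a x : R) : `|a * sin x| <= `|a| by rewrite normrM ler_piMr// sin_max.
have Dn (a : R) : a ^+ 2 = D ^+ 2 -> `|a| <= D.
  by move=> aD; rewrite -(ger0_norm D0) -ler_sqr ?nnegrE// !real_normK ?num_real// aD.
have L1 : lipschitz_fun D (fun x => - (w * nu) * sin (nu * x)).
  apply: (@deriv_lipschitz _ _ _ _ (fun x => is_derive_sin_scale nu (- (w * nu)) x)) => x.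
  by apply: le_trans (bc _ _) (Dn _ _); rewrite /D; ring.
have L2 : lipschitz_fun D (fun x => w * nu * cos (nu * x)).
  apply: (@deriv_lipschitz _ _ _ _ (fun x => is_derive_cos_scale nu (w * nu) x)) => x.
  by apply: le_trans (bs _ _) (Dn _ _); rewrite /D; ring.
have D1 (x : R) := is_derive_cos_scale nu w x.
have D2 (x : R) := is_derive_sin_scale nu w x.
have El1 := @interp_error_lipschitz h x1 h0 t1 _ D D1 D0 L1.
have El2 := @interp_error_lipschitz h x1 h0 t2 _ D D2 D0 L2.
have Eb1 := @interp_error_bound h x1 h0 t1 _ D D1 D0 L1.
have Eb2 := @interp_error_bound h x1 h0 t2 _ D D2 D0 L2.
have p1 x : t1 (x + 4) = t1 x.
  by rewrite /t1; have /(congr1 (@Re R)) /= -> := cis_mode_periodic k x.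
have p2 x : t2 (x + 4) = t2 x.
  by rewrite /t2; have /(congr1 (@Im R)) /= -> := cis_mode_periodic k x.
have ct1 : continuous t1 by move=> x; apply: cvgM; [exact: cvg_cst|exact: continuous_cos_scale].
have ct2 : continuous t2 by move=> x; apply: cvgM; [exact: cvg_cst|exact: continuous_sin_scale].
(* Continuity of the interpolant is read off from the Lipschitz error. *)
have ci t : continuous t -> continuous (fun x => t x - interp h x1 t x) ->
    continuous (interp h x1 t).
  move=> ct cE x; have -> : interp h x1 t = (fun x => t x - (t x - interp h x1 t x)).
    by apply/funext => y; rewrite subKr.
  by apply: cvgB; [exact: ct|exact: cE].
have c1 := ci _ ct1 (lipschitz_fun_continuous El1).
have c2 := ci _ ct2 (lipschitz_fun_continuous El2).
pose u x : C := Complex (interp h x1 t1 x) (interp h x1 t2 x).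
have ub t x : `|t x| <= w -> `|t x - interp h x1 t x| <= D * h * h ->
    `|interp h x1 t x| <= w + D * h * h.
  move=> tw tE; rewrite -[interp _ _ _ _](subKr (t x)).
  by apply: (le_trans (ler_normB _ _)); rewrite lerD.
have su : sqi u.
  apply: (@sqi_bounded _ _ (w + D * h * h)) => [| |x].
  - exact: continuous_measurable_fun.
  - exact: continuous_measurable_fun.
  - by split; apply: ub => //; rewrite /t1 /t2 -[leRHS](ger0_norm w0) ?bc ?bs.
exists (L2_of u).
  exists u; first exact: interp_piecewise_linear.
  exact: repr_L2_of.
have sm := sqi_mode R k.
have -> : modeL2 R k - L2_of u = L2_of (fun x => fourier_mode k x + (-1) * u x).
  rewrite (L2_ofD sm); last exact: sqiZ.
  by rewrite (L2_ofZ _ su) scaleN1r.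
have gRe x : Re (fourier_mode k x + (-1) * u x) = t1 x - interp h x1 t1 x.
  by rewrite fourier_modeE !cpartE /= -/w -/nu /t1; ring.
have gIm x : Im (fourier_mode k x + (-1) * u x) = t2 x - interp h x1 t2 x.
  by rewrite fourier_modeE !cpartE /= -/w -/nu /t2; ring.
(* As h <= 4, the term h^4 is at most 16 h^2, and 160 = 8 * 16 + 32. *)
apply: (@sobolev_leW _ _ (8 * (D * h * h) ^+ 2 + 32 * (D * h) ^+ 2)).
  rewrite -/D; have h16 : h ^+ 2 <= 16 by have := sqr_ge0 h; nra.
  have h2 : 0 <= 16 - h ^+ 2 by rewrite subr_ge0.
  have := mulr_ge0 (mulr_ge0 (sqr_ge0 D) (sqr_ge0 h)) h2.
  move: (D) (h) => a b; lra.
apply: sobolev_le_lipschitz => [x|||x].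
- by rewrite gRe gIm.
- by move=> x y; rewrite !gRe.
- by move=> x y; rewrite !gIm.
- rewrite /u !(@interp_periodic _ x1 h0 _ _ _ hn)// !fourier_modeE cis_mode_periodic//.
Qed.

End Interpolation.

(** * Completeness of the Fourier modes *)

Section Steepening.
Variable R : realType.

Lemma bernoulli_ineq (t : R) n : 0 <= 1 + t -> 1 + n%:R * t <= (1 + t) ^+ n.
Proof.
move=> t0; elim: n => [|n ih]; first by rewrite mul0r addr0 expr0.
rewrite exprS -[n.+1]addn1 natrD; apply: le_trans (ler_wpM2l t0 ih).
have : 0 <= n%:R * t ^+ 2 by rewrite mulr_ge0 ?sqr_ge0.
by rewrite mulrDl mul1r expr2; nra.
Qed.

(** The polynomials of the elementary proof of the Stone-Weierstrass theorem. The exponent [2 ^ n]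
    places the threshold at 1/2, because Bernoulli's inequality compares with 2^n s^n = (2 s)^n. *)
Definition steep (n : nat) (s : R) : R := (1 - s ^+ n) ^+ (2 ^ n).

Lemma steep_itv n s : 0 <= s <= 1 -> 0 <= steep n s <= 1.
Proof.
move=> /andP[s0 s1]; have sn0 : 0 <= s ^+ n by exact: exprn_ge0.
have sn1 : s ^+ n <= 1 by exact: exprn_ile1.
rewrite exprn_ge0 ?subr_ge0//= exprn_ile1// ?subr_ge0//; lra.
Qed.

Lemma steep_cvg1 s : 0 <= s < 2^-1 -> steep n s @[n --> \oo] --> (1 : R).
Proof.
move=> /andP[s0 s1]; have s01 : 0 <= s <= 1 by lra.
apply: (@squeeze_cvgr _ _ _ _ (fun n => 1 - (2 * s) ^+ n) (cst 1)); last exact: cvg_cst.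
  near=> n; have /andP[_ ->] := steep_itv n s01; rewrite andbT.
  have := @bernoulli_ineq (- s ^+ n) (2 ^ n).
  have sn1 : s ^+ n <= 1 by apply: exprn_ile1; lra.
  rewrite subr_ge0 => /(_ sn1); apply: le_trans.
  by rewrite natrX mulrN -exprMn.
have E : 1 - 0 = 1 :> R by rewrite subr0.
rewrite -[X in _ --> X]E.
apply: cvgB; first exact: cvg_cst.
by apply: cvg_expr; rewrite ger0_norm; lra.
Unshelve. all: by end_near. Qed.

(** With x = s^n and m = 2^n, the product (1 - x)^m (1 + x)^m is at most 1, while (1 + x)^m >= m x =
    (2 s)^n; hence the bound by (2 s)^-n. *)
Lemma steep_cvg0 s : 2^-1 < s <= 1 -> steep n s @[n --> \oo] --> (0 : R).
Proof.
move=> /andP[s0 s1]; have s01 : 0 <= s <= 1 by lra.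
have s2 : 0 < 2 * s by lra.
apply: (@squeeze_cvgr _ _ _ _ (cst 0) (fun n => (2 * s)^-1 ^+ n)); [|exact: cvg_cst|].
  near=> n; have /andP[-> _] := steep_itv n s01; rewrite /= exprVn.
  rewrite -[leRHS]div1r ler_pdivlMr ?exprn_gt0//.
  have sn0 : 0 <= s ^+ n by apply: exprn_ge0; lra.
  have sn1 : s ^+ n <= 1 by apply: exprn_ile1; lra.
  apply: (@le_trans _ _ (steep n s * (1 + s ^+ n) ^+ (2 ^ n))).
    apply: ler_wpM2l; first by have /andP[] := steep_itv n s01.
    apply: (@le_trans _ _ (1 + (2 ^ n)%:R * s ^+ n)); last by apply: bernoulli_ineq; lra.
    by rewrite natrX exprMn lerDr.
  rewrite -exprMn exprn_ile1//; nra.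
apply: cvg_expr; rewrite ger0_norm ?invr_ge0 ?(ltW s2)//.
by rewrite invf_lt1//; lra.
Unshelve. all: by end_near. Qed.

End Steepening.

(** * Trigonometric approximation of every square-integrable function *)

Section Density.
Variable R : realType.
Notation mu := (bdry_measure R).
Notation C := R[i].
Notation H := (L2 R).

(** The span of the modes as functions rather than classes, so that pointwise products make sense.
    Closure under products comes from [cisD], and allows [steep] to be applied to a trigonometric
    polynomial. *)
Inductive trig_poly : (R -> C) -> Prop :=
| trig_poly_cis k : trig_poly (fun x => cis (frequency R k * x))
| trig_polyD f g : trig_poly f -> trig_poly g -> trig_poly (fun x => f x + g x)
| trig_polyZ a f : trig_poly f -> trig_poly (fun x => a * f x).

Lemma trig_poly_cst a : trig_poly (fun=> a).
Proof.
have := trig_polyZ a (trig_poly_cis 0); congr trig_poly; apply/funext => x.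
by rewrite /frequency mulr0 mul0r mul0r cis0 mulr1.
Qed.

Lemma trig_polyM f g : trig_poly f -> trig_poly g -> trig_poly (fun x => f x * g x).
Proof.
move=> tf; elim=> {g} [k|g1 g2 _ h1 _ h2|a g _ h].
- elim: tf => {f} [j|f1 f2 _ h1 _ h2|a f _ h].
  + have := trig_poly_cis (j + k); congr trig_poly; apply/funext => x.
    by rewrite frequencyD mulrDl cisD.
  + have := trig_polyD h1 h2; congr trig_poly; apply/funext => x.
    by rewrite mulrDl.
  + have := trig_polyZ a h; congr trig_poly; apply/funext => x.
    by rewrite mulrA.
- have := trig_polyD h1 h2; congr trig_poly; apply/funext => x.
  by rewrite mulrDr.
- have := trig_polyZ a h; congr trig_poly; apply/funext => x.
  by rewrite mulrCA.
Qed.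

Lemma trig_polyX f n : trig_poly f -> trig_poly (fun x => f x ^+ n).
Proof.
move=> tf; elim: n => [|n ih]; first exact: trig_poly_cst.
have := trig_polyM tf ih; congr trig_poly; apply/funext => x.
by rewrite exprS.
Qed.

Lemma trig_poly_approximable f : trig_poly f -> sqi f /\ trig_approximable (L2_of f).
Proof.
elim=> {f} [k|f g _ [sf af] _ [sg ag]|a f _ [sf af]].
- have s := sqi_cis (frequency R k); split => //.
  have w0 : mode_scale R != 0.
    by rewrite invr_neq0// sqrtr_eq0 -ltNge /perimeter.
  have -> : L2_of (fun x => cis (frequency R k * x)) = ((mode_scale R)^-1)%:C%C *: modeL2 R k.
    rewrite -L2_ofZ; last exact: sqi_mode.
    congr L2_of; apply/funext => x; rewrite fourier_modeE mulrA.
    by rewrite -rmorphM mulVf// mul1r.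
  exact: trig_approximableZ (trig_approximable_mode _).
- split; first exact: sqiD.
  by rewrite L2_ofD//; exact: trig_approximableD.
- split; first exact: sqiZ.
  by rewrite L2_ofZ//; exact: trig_approximableZ.
Qed.

Lemma Lfun2_lin a (u v : R -> R) : u \in Lfun mu 2%:E -> v \in Lfun mu 2%:E ->
  (fun x => a * u x + v x) \in Lfun mu 2%:E.
Proof.
have two : (1 <= 2%:E :> \bar R)%E by rewrite lee_fin ler1n.
by have [_ LZ] := Lfun_submod_closed mu two; exact: LZ.
Qed.

Lemma Lfun2_0 : (fun=> 0 : R) \in Lfun mu 2%:E.
Proof. by apply: (@Lfun2_bounded _ _ 0) => // x; rewrite normr0. Qed.

Lemma Lfun2Z a (u : R -> R) : u \in Lfun mu 2%:E -> (fun x => a * u x) \in Lfun mu 2%:E.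
Proof.
move=> uL; have := Lfun2_lin a uL Lfun2_0.
by under eq_fun do rewrite addr0.
Qed.

Lemma Lfun2D (u v : R -> R) : u \in Lfun mu 2%:E -> v \in Lfun mu 2%:E ->
  (fun x => u x + v x) \in Lfun mu 2%:E.
Proof.
move=> uL vL; have := Lfun2_lin 1 uL vL.
by under eq_fun do rewrite mul1r.
Qed.

Definition realfun_L2 (u : R -> R) : H := L2_of (fun x => (u x)%:C%C).

Lemma sqi_realfun u : u \in Lfun mu 2%:E -> sqi (fun x => (u x)%:C%C).
Proof.
by move=> uL; apply/sqi_parts; split => //=; exact: Lfun2_0.
Qed.

Lemma realfun_L2D u v : u \in Lfun mu 2%:E -> v \in Lfun mu 2%:E ->
  realfun_L2 (fun x => u x + v x) = realfun_L2 u + realfun_L2 v.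
Proof.
move=> uL vL; rewrite -L2_ofD; try exact: sqi_realfun.
by congr L2_of; apply/funext => x; rewrite rmorphD.
Qed.

Lemma realfun_L2Z a u : u \in Lfun mu 2%:E ->
  realfun_L2 (fun x => a * u x) = a%:C%C *: realfun_L2 u.
Proof.
move=> uL; rewrite -L2_ofZ; last exact: sqi_realfun.
by congr L2_of; apply/funext => x; rewrite rmorphM.
Qed.

(** Pointwise limits suffice for L^2 closure: |f - f_n|^2 is dominated by 4 g^2, which is integrable
    because g is square-integrable. *)
Lemma trig_approximable_dominated (f_ : nat -> R -> R) (f g : R -> R) :
  (forall n, measurable_fun setT (f_ n)) -> measurable_fun setT f ->
  g \in Lfun mu 2%:E -> (forall n x, `|f_ n x| <= g x) -> (forall x, `|f x| <= g x) ->
  {ae mu, forall x, f_ n x @[n --> \oo] --> f x} ->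
  (forall n, trig_approximable (realfun_L2 (f_ n))) ->
  trig_approximable (realfun_L2 f).
Proof.
move=> mf_ mf gL f_g fg f_f af.
have le_g (u : R -> R) : measurable_fun setT u -> (forall x, `|u x| <= g x) -> u \in Lfun mu 2%:E.
  by move=> mu_ ug; apply: Lfun2_le gL => // x; exact: le_trans (ug x) (ler_norm _).
have fL := le_g _ mf fg; have f_L n := le_g _ (mf_ n) (f_g n).
have sqE n : sqnorm (realfun_L2 f - realfun_L2 (f_ n)) = \int[mu]_x (f x - f_ n x) ^+ 2.
  have -> : realfun_L2 f - realfun_L2 (f_ n) = realfun_L2 (fun x => f x + (-1) * f_ n x).
    rewrite realfun_L2D//; last exact: Lfun2Z.
    by rewrite realfun_L2Z// rmorphN1 scaleN1r.
  rewrite sqnorm_inner inner_L2_of; last 2 first.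
  - by apply: sqi_realfun; apply: Lfun2D => //; exact: Lfun2Z.
  - by apply: sqi_realfun; apply: Lfun2D => //; exact: Lfun2Z.
  by apply: eq_Rintegral => x _; rewrite !cpartE /=; ring.
have gi : mu.-integrable setT (fun x => 4%:E * (g x ^+ 2)%:E)%E.
  exact: integrableZl (Lfun2_integrable_sqr gL).
have mh n : measurable_fun setT (fun x => ((f x - f_ n x) ^+ 2)%:E).
  apply/measurable_EFinP; apply: measurable_funX; exact: measurable_funB.
have hh : {ae mu, forall x, setT x -> ((f x - f_ n x) ^+ 2)%:E @[n --> \oo] --> (0%:E : \bar R)}.
  have aeF : Filter (almost_everywhere mu) by exact: ae_filter_ringOfSetsType.
  move: f_f; apply: filterS => x fx _; apply: cvg_EFin; first exact: nearW.
  have -> : 0 = (f x - f x) ^+ 2 :> R by rewrite subrr expr0n.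
  rewrite /comp /=; under eq_fun do rewrite expr2.
  by rewrite expr2; apply: cvgM; (apply: cvgB; [exact: cvg_cst|exact: fx]).
have hg : {ae mu, forall x n, setT x -> (`|((f x - f_ n x) ^+ 2)%:E| <= 4%:E * (g x ^+ 2)%:E)%E}.
  apply: aeW => x n _; rewrite -EFinM /= lee_fin ger0_norm ?sqr_ge0//.
  have := f_g n x; have := fg x; rewrite !ler_norml; nra.
have [_ _] := @dominated_convergence _ (measurableTypeR R) R mu setT measurableT
  (fun n x => ((f x - f_ n x) ^+ 2)%:E) (cst 0%:E) _ mh (measurable_cst _) hh gi hg.
rewrite integral0 => /fine_cvg h0.
apply: trig_approximable_closed => e e0.
have /cvgrPdist_le/(_ e e0)[n _ /(_ n (leqnn n))] := h0.
rewrite /= sub0r normrN => hn; exists (realfun_L2 (f_ n)); first exact: af.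
rewrite sqE; apply: le_trans hn; exact: ler_norm.
Qed.

(** At 0 and at [a] the level used for the ray is exactly 1/2, where the steep polynomials converge
    to neither 0 nor 1; these points are null. *)
Lemma bdry_ae_interior (a : R) : {ae mu, forall x, 0 < x < 4 /\ x != a}.
Proof.
exists ([set 0] `|` [set a] `|` ~` `[0, perimeter R[); split.
- by apply: measurableU; [exact: measurableU|exact: measurableC].
- rewrite /= /mrestr; apply/eqP; rewrite eq_le measure_ge0 andbT.
  apply: (@le_trans _ _ (lebesgue_measure ([set 0; a] : set R))).
    apply: le_measure; rewrite ?inE//.
    + by apply: measurableI => //; apply: measurableU; [exact: measurableU|exact: measurableC].
    + exact: measurableU.
    + by move=> x [[//|nx] xx].
  rewrite (@le_trans _ _ (lebesgue_measure [set (0%R : R)] + lebesgue_measure [set a])%E)//.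
    exact: measureU2.
  by rewrite !lebesgue_measure_set1 adde0.
- move=> x /=; apply: contra_notP => /not_orP[/not_orP[x0 xa]] /contrapT.
  rewrite /= in_itv /= /perimeter => /andP[x0' ->]; split; last exact/eqP.
  by rewrite andbT lt_neqAle x0' andbT eq_sym; apply/eqP.
Qed.

Lemma indic_bound (A : set R) x : `|\1_A x| <= 1 :> R.
Proof. by rewrite indicE; case: (_ \in _); rewrite ?normr1 ?normr0. Qed.

Lemma Lfun2_cst1 : (fun=> 1 : R) \in Lfun mu 2%:E.
Proof. by apply: (@Lfun2_bounded _ _ 1) => // x; rewrite normr1. Qed.

Lemma Lfun2_indic (A : set (measurableTypeR R)) : measurable A ->
  (\1_A : R -> R) \in Lfun mu 2%:E.
Proof. by move=> mA; apply: (@Lfun2_bounded _ _ 1) => // x; exact: indic_bound. Qed.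

Lemma trig_approximable_cst a : trig_approximable (realfun_L2 (fun=> a)).
Proof. by have [] := trig_poly_approximable (trig_poly_cst a%:C%C). Qed.

(* On ]0, 4[ the trigonometric polynomial
   cos (pi a / 4) - cos (pi x / 2 - pi a / 4) = 2 sin (pi x / 4) sin (pi (x - a) / 4)
   has the sign of x - a. *)
Definition ray_level (a x : R) : R :=
  2^-1 - (cos (pi * a / 4) - cos (frequency R 1 * x - pi * a / 4)) / 4.

Lemma trig_poly_ray_level a : trig_poly (fun x => (ray_level a x)%:C%C).
Proof.
set al := pi * a / 4.
(* By Euler's formula, cos q / 4 is the sum of exp(iq) / 8 and exp(-iq) / 8. *)
have t1 := trig_polyZ ((8^-1)%:C%C * cis (- al)) (trig_poly_cis 1).
have t2 := trig_polyZ ((8^-1)%:C%C * cis al) (trig_poly_cis (-1)).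
have := trig_polyD (trig_poly_cst (2^-1 - cos al / 4)%:C%C) (trig_polyD t1 t2).
congr trig_poly; apply/funext => x.
have -> : frequency R (-1) = - frequency R 1 by rewrite -frequencyN.
rewrite /ray_level -/al; move: (frequency R 1) => nu.
rewrite -!mulrA -!cisD mulNr [- al + _]addrC.
have -> : al + - (nu * x) = - (nu * x - al) by ring.
by rewrite cisN; apply: complex_eqP; rewrite !cpartE /=; field.
Qed.

(** A difference of two cosines lies in [-2, 2]; dividing by 4 keeps the level within 1/2 of 1/2, as
    [steep] requires. *)
Lemma ray_level_itv a x : 0 <= ray_level a x <= 1.
Proof.
rewrite /ray_level; set p := pi * _ / _; set q := _ - p.
have := cos_le1 p; have := cos_geN1 p; have := cos_le1 q; have := cos_geN1 q.
by move=> *; apply/andP; split; lra.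
Qed.

(** The angle [th] lies in ]0, pi[, where the sine is positive, and [ga] lies in ]-pi, pi[, where
    the sine has the sign of x - a. Each factor alone has period 8; only the product has period
    4. *)
Lemma ray_level_sign a x : 0 < a < 4 -> 0 < x < 4 ->
  (a < x -> ray_level a x < 2^-1) /\ (x < a -> 2^-1 < ray_level a x).
Proof.
move=> /andP[a0 a4] /andP[x0 x4].
pose th : R := pi * x / 4; pose ga : R := pi * (x - a) / 4.
have E : cos (pi * a / 4) - cos (frequency R 1 * x - pi * a / 4) = 2 * sin th * sin ga.
  have -> : pi * a / 4 = th - ga by rewrite /th /ga; field.
  have -> : frequency R 1 * x - (th - ga) = th + ga.
    by rewrite /frequency /perimeter /th /ga; field.
  by rewrite cosB cosD; ring.
have p0 := pi_gt0 R.
have st : 0 < sin th.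
  apply: sin_gt0_pi; rewrite /th divr_gt0 ?mulr_gt0//= ltr_pdivrMr// ltr_pM2l//.
rewrite /ray_level E; split => xa.
  have : 0 < sin ga.
    apply: sin_gt0_pi; rewrite /ga divr_gt0 ?mulr_gt0 ?subr_gt0//= ltr_pdivrMr// ltr_pM2l//; lra.
  by nra.
have : 0 < sin (- ga).
  apply: sin_gt0_pi; have -> : - ga = pi * (a - x) / 4 by rewrite /ga; field.
  rewrite divr_gt0 ?mulr_gt0 ?subr_gt0//= ltr_pdivrMr// ltr_pM2l//; lra.
by rewrite sinN; nra.
Qed.

Lemma trig_approximable_ray a : trig_approximable (realfun_L2 (\1_(`]a, +oo[ : set R))).
Proof.
have mray : measurable_fun setT (\1_(`]a, +oo[ : set R) : R -> R) by exact: measurable_indic.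
have rayE x : \1_(`]a, +oo[ : set R) x = (a < x)%R%:R :> R.
  by rewrite indicE mem_setE in_itv /= andbT.
(* A ray starting outside ]0, 4[ has an indicator that is almost everywhere 1 or 0 on the
   boundary. *)
have [a0|a0] := leP a 0.
  apply: (@trig_approximable_dominated (fun _ _ => 1) _ (fun=> 1)) => //.
  - exact: Lfun2_cst1.
  - by move=> _ x; rewrite normr1.
  - by move=> x; exact: indic_bound.
  - have aeF : Filter (almost_everywhere mu) by exact: ae_filter_ringOfSetsType.
    have := bdry_ae_interior 0; apply: filterS => x [/andP[x0 _] _].
    by rewrite rayE (le_lt_trans a0 x0); exact: cvg_cst.
  - by move=> _; exact: trig_approximable_cst.
have [a4|a4] := leP 4 a.
  apply: (@trig_approximable_dominated (fun _ _ => 0) _ (fun=> 1)) => //.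
  - exact: Lfun2_cst1.
  - by move=> _ x; rewrite normr0.
  - by move=> x; exact: indic_bound.
  - have aeF : Filter (almost_everywhere mu) by exact: ae_filter_ringOfSetsType.
    have := bdry_ae_interior 0; apply: filterS => x [/andP[_ x4] _].
    by rewrite rayE ltNge (ltW (lt_le_trans x4 a4)); exact: cvg_cst.
  - by move=> _; exact: trig_approximable_cst.
have tp n : trig_poly (fun x => (steep n (ray_level a x))%:C%C).
  have t1 := trig_polyX n (trig_poly_ray_level a).
  have t2 := trig_polyX (2 ^ n) (trig_polyD (trig_poly_cst 1) (trig_polyZ (-1) t1)).
  move: t2; congr trig_poly; apply/funext => x.
  have <- : (1 - ray_level a x ^+ n)%:C%C = 1 + -1 * (ray_level a x)%:C%C ^+ n :> C.
    by rewrite rmorphB rmorphXn rmorph1 mulN1r.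
  exact/esym/rmorphXn.
apply: (@trig_approximable_dominated (fun n x => steep n (ray_level a x)) _ (fun=> 1)) => //.
(* Measurability is part of the square-integrability of a trigonometric polynomial. *)
- move=> n; have [/sqi_parts[+ _] _] := trig_poly_approximable (tp n).
  by rewrite inE => /andP[]; rewrite inE.
- exact: Lfun2_cst1.
- by move=> n x; have /andP[? ?] := steep_itv n (ray_level_itv a x); rewrite ger0_norm.
- by move=> x; exact: indic_bound.
- have aeF : Filter (almost_everywhere mu) by exact: ae_filter_ringOfSetsType.
  have := bdry_ae_interior a; apply: filterS => x [x04 xa].
  have a04 : 0 < a < 4 by rewrite a0.
  have [lo hi] := ray_level_sign a04 x04; have /andP[r0 r1] := ray_level_itv a x.
  rewrite rayE; case: ltP => ax.
    by apply: steep_cvg1; rewrite r0 lo.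
  by apply: steep_cvg0; rewrite r1 andbT hi// lt_neqAle xa.
- by move=> n; have [] := trig_poly_approximable (tp n).
Qed.

(** Rays are stable under intersection and generate the Borel sets, so it remains to pass to
    complements and countable disjoint unions. *)
Lemma trig_approximable_indic (A : set (measurableTypeR R)) : measurable A ->
  trig_approximable (realfun_L2 (\1_A)).
Proof.
rewrite {1}RGenOInfty.measurableE; move: A.
apply: (@dynkin_induction _ (measurableTypeR R) (@RGenOInfty.G R)
  (fun A => trig_approximable (realfun_L2 (\1_A)))).
- exact: RGenOInfty.measurableE.
- move=> _ _ [a ->] [b ->]; exists (Num.max a b).
  apply/seteqP; split => x /=; rewrite !in_itv /= !andbT gt_max.
    by case=> -> ->.
  by move=> /andP.
- have -> : (\1_[set: measurableTypeR R] : R -> R) = (fun=> 1).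
    by apply/funext => x; rewrite indicE in_setT.
  exact: trig_approximable_cst.
- by move=> _ [a ->]; exact: trig_approximable_ray.
- move=> S mS aS.
  have -> : (\1_(~` S) : R -> R) = (fun x => 1 + (-1) * \1_S x).
    apply/funext => x; rewrite !indicE in_setC; case: (x \in S) => /=; lra.
  rewrite realfun_L2D; [|exact: Lfun2_cst1|by apply: Lfun2Z; exact: Lfun2_indic].
  rewrite realfun_L2Z; last exact: Lfun2_indic.
  apply: trig_approximableD; first exact: trig_approximable_cst.
  exact: trig_approximableZ.
- move=> F mF tF aF.
  (* Disjointness makes the indicators of the finite unions additive; dominated convergence then
     reaches the countable union. *)
  pose G n := \bigcup_(k in [set k | (k < n)%N]) F k.
  have mG n : measurable (G n) by apply: bigcup_measurable => k _; exact: mF.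
  have GS n : (\1_(G n.+1) : R -> R) = (fun x => \1_(G n) x + \1_(F n) x).
    apply/funext => x; rewrite !indicE.
    have [Fx|Fx] := boolP (x \in F n).
      have -> : x \in G n.+1 by apply/mem_set; exists n => //=; exact: set_mem.
      have -> : x \in G n = false; last by rewrite add0r.
      apply/negbTE/negP => /set_mem [k /= kn Fk].
      have : k = n by apply: tF => //; exists x; split => //; exact: set_mem.
      by move=> kE; rewrite kE ltnn in kn.
    rewrite addr0; congr (_%:R); congr nat_of_bool; apply/idP/idP => /set_mem [k /= kn Fk].
      apply/mem_set; exists k => //=; move: kn; rewrite ltnS leq_eqVlt => /predU1P[kE|//].
      by move: Fx; rewrite -kE mem_set.
    by apply/mem_set; exists k => //=; exact: ltnW.
  have aG n : trig_approximable (realfun_L2 (\1_(G n))).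
    elim: n => [|n ih].
      have -> : (\1_(G 0%N) : R -> R) = (fun=> 0); last exact: trig_approximable_cst.
      apply/funext => x; rewrite indicE; case: (boolP (x \in G 0%N)) => // /set_mem [k].
      by [].
    rewrite GS realfun_L2D; try exact: Lfun2_indic.
    exact: trig_approximableD.
  apply: (@trig_approximable_dominated (fun n => \1_(G n)) _ (fun=> 1)) => //.
  + by move=> n; apply: measurable_indic; exact: mG.
  + by apply: measurable_indic; apply: bigcup_measurable => k _; exact: mF.
  + exact: Lfun2_cst1.
  + by move=> n x; exact: indic_bound.
  + by move=> x; exact: indic_bound.
  + apply: aeW => x; apply: cvg_near_cst.
    have [[k _ Fk]|nF] := pselect ((\bigcup_k F k) x).
      near=> n; rewrite !indicE; congr (_%:R); congr nat_of_bool.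
      rewrite !mem_set//; first by exists k.
      by exists k => //=; near: n; exact: nbhs_infty_gt.
    near=> n; rewrite !indicE; congr (_%:R); congr nat_of_bool.
    rewrite !memNset//; move=> [k _ Fk]; apply: nF; by exists k.
Unshelve. all: by end_near. Qed.

(** The simple approximations increase to [u], so [u] itself is the dominating function; each of
    them is a finite combination of indicators of its level sets. *)
Lemma trig_approximable_nneg (u : R -> R) : u \in Lfun mu 2%:E ->
  (forall x, 0 <= u x) -> trig_approximable (realfun_L2 u).
Proof.
move=> uL u0; have mu_ : measurable_fun setT u.
  by move: uL; rewrite inE => /andP[]; rewrite inE.
have mE : measurable_fun setT (EFin \o u) by exact/measurable_EFinP.
pose f n := nnsfun_approx measurableT mE n.
have fu x : f n x @[n --> \oo] --> u x.
  have := @cvg_nnsfun_approx _ _ _ _ measurableT _ mE (fun x _ => u0 x) x I.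
  by move/fine_cvg.
have fle n x : f n x <= u x.
  have nd : nondecreasing_seq (fun n => f n x).
    by move=> m p mp; have /lefP := nd_nnsfun_approx measurableT mE mp; apply.
  have := nondecreasing_cvgn_le nd (cvgP _ (fu x)) n.
  by rewrite (cvg_lim _ (fu x)).
have f0 n x : 0 <= f n x by exact: fun_ge0.
apply: (@trig_approximable_dominated (fun n => f n) _ u) => //.
- by move=> n x; rewrite ger0_norm.
- by move=> x; rewrite ger0_norm.
- exact: aeW.
move=> n.
have -> : (f n : R -> R) = (fun x => \sum_(y <- finmap.enum_fset (fset_set (range (f n))))
    y * \1_(f n @^-1` [set y]) x).
  by apply/funext => x; rewrite [LHS]fimfunE fsbig_finite.
have mp y : measurable (f n @^-1` [set y]) by exact: measurable_sfunP.
have yL y : (fun x => y * \1_(f n @^-1` [set y]) x) \in Lfun mu 2%:E.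
  by apply: Lfun2Z; exact: Lfun2_indic (mp y).
elim: (finmap.enum_fset _) => [|y s ih].
  by under eq_fun do rewrite big_nil; exact: trig_approximable_cst.
under eq_fun do rewrite big_cons.
rewrite realfun_L2D//; last first.
  elim: s {ih} => [|z s ih].
    by under eq_fun do rewrite big_nil; exact: Lfun2_0.
  under eq_fun do rewrite big_cons.
  exact: Lfun2D.
apply: trig_approximableD => //.
rewrite realfun_L2Z; last exact: Lfun2_indic (mp y).
by apply: trig_approximableZ; exact: trig_approximable_indic (mp y).
Qed.

Lemma trig_approximable_real (u : R -> R) : u \in Lfun mu 2%:E ->
  trig_approximable (realfun_L2 u).
Proof.
move=> uL; have mu_ : measurable_fun setT u.
  by move: uL; rewrite inE => /andP[]; rewrite inE.
pose p (x : R) := Num.max (u x) 0; pose m (x : R) := Num.max (- u x) 0.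
have mp : measurable_fun setT p by exact: measurable_maxr.
have mm : measurable_fun setT m.
  by apply: measurable_maxr => //; exact: measurableT_comp.
have pL : p \in Lfun mu 2%:E.
  apply: Lfun2_le uL => // x; rewrite /p; case: (leP (u x) 0) => ux; by rewrite ?normr0 ?normr_ge0.
have mL : m \in Lfun mu 2%:E.
  apply: Lfun2_le uL => // x; rewrite /m; case: (leP (- u x) 0) => ux; by rewrite ?normr0 ?normr_ge0 ?normrN.
have -> : u = (fun x => p x + (-1) * m x).
  by apply/funext => x; rewrite /p /m; case: (leP (u x) 0) => ?; case: (leP (- u x) 0) => ?; lra.
rewrite realfun_L2D ?realfun_L2Z//; last exact: Lfun2Z.
apply: trig_approximableD; last apply: trig_approximableZ;
  by apply: trig_approximable_nneg => // x; rewrite le_max lexx orbT.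
Qed.

Lemma trig_approximable_all (f : H) : trig_approximable f.
Proof.
have sf := sqi_repr f; have /sqi_parts[rL iL] := sf.
have -> : f = realfun_L2 (fun x => Re (L2_repr f x)) + 'i%C *: realfun_L2 (fun x => Im (L2_repr f x)).
  rewrite -L2_ofZ; last exact: sqi_realfun.
  rewrite -L2_ofD; [|exact: sqi_realfun|by apply: sqiZ; exact: sqi_realfun].
  rewrite -[LHS]L2_of_repr; congr L2_of; apply/funext => x.
  by apply: complex_eqP; rewrite !cpartE /=; ring.
apply: trig_approximableD; last apply: trig_approximableZ; exact: trig_approximable_real.
Qed.

End Density.

(** * Strong convergence of the projectors *)

Section SobolevNorm.
Variable R : realType.
Notation C := R[i].
Notation H := (L2 R).
Implicit Types (f g : H).

Definition sobolev_sqnorm f : \bar R :=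
  (\esum_(k in [set: int]) (sobolev_term f k)%:E)%E.

Lemma H12_normE f : H12_norm f = (sobolev_sqnorm f `^ 2^-1)%E.
Proof.
congr ((_ `^ _)%E); apply: eq_esum => k _.
by rewrite /sobolev_term sqr_normc_sqnormc.
Qed.

Lemma sobolev_sqnorm_ge0 f : (0 <= sobolev_sqnorm f)%E.
Proof. by apply: esum_ge0 => k _; rewrite lee_fin sobolev_term_ge0. Qed.

Lemma sobolev_leP f B : (sobolev_sqnorm f <= B%:E)%E <-> sobolev_le f B.
Proof.
split=> [fB s us|fB].
  rewrite -lee_fin; apply: le_trans fB; apply: esum_ge.
  exists [set` s]; first by split => //; exact: finite_seq.
  by rewrite -fsbig_seq// -sumEFin.
apply: ub_ereal_sup => _ [X [finX _] <-].
rewrite fsbig_finite// sumEFin lee_fin; apply: fB.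
exact: finmap.fset_uniq.
Qed.

Lemma H12_norm_leP f (r : R) : 0 <= r ->
  (H12_norm f <= r%:E)%E <-> sobolev_le f (r ^+ 2).
Proof.
move=> r0; apply: iff_trans (sobolev_leP f _).
rewrite H12_normE; have := sobolev_sqnorm_ge0 f.
case: (sobolev_sqnorm f) => [e||//]; last first.
  by move=> _; rewrite poweRyr ?invr_neq0//; split; rewrite leye_eq.
rewrite lee_fin => e0; rewrite poweR_EFin powR12_sqrt// !lee_fin.
by rewrite -ler_sqr ?nnegrE ?sqrtr_ge0// sqr_sqrtr.
Qed.

Lemma H12P f : H12 f <-> exists B, sobolev_le f B.
Proof.
split=> [|[B fB]].
  rewrite /H12 /= => fy; have := H12_norm_leP f (r := fine (H12_norm f)).
  have n0 : (0 <= H12_norm f)%E by exact: poweR_ge0.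
  rewrite fineK ?ge0_fin_numE// => h; exists (fine (H12_norm f) ^+ 2).
  by apply/h; rewrite ?fine_ge0.
have B0 := sobolev_le_ge0 fB.
apply: (@le_lt_trans _ _ (Num.sqrt B)%:E); last exact: ltry.
by apply/H12_norm_leP; rewrite ?sqrtr_ge0// sqr_sqrtr.
Qed.

(** The sign of [c] is unknown, so the square root of c^2 B is taken with |c|. *)
Lemma sobolev_le_bounded_op (T : H -> H) (c : R) :
  (forall f, H12 f -> (H12_norm (T f) <= c%:E * H12_norm f)%E) ->
  forall f B, sobolev_le f B -> sobolev_le (T f) (c ^+ 2 * B).
Proof.
move=> Tc f B fB; have B0 := sobolev_le_ge0 fB.
have -> : c ^+ 2 * B = (`|c| * Num.sqrt B) ^+ 2.
  by rewrite exprMn sqr_sqrtr// real_normK// num_real.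
have n0 : (0 <= H12_norm f)%E by exact: poweR_ge0.
apply/H12_norm_leP; first by rewrite mulr_ge0// sqrtr_ge0.
apply: (le_trans (Tc f _)); first by apply/H12P; exists B.
rewrite EFinM; apply: (@le_trans _ _ (`|c|%:E * H12_norm f)%E).
  by apply: lee_wpmul2r => //; rewrite lee_fin ler_norm.
apply: lee_wpmul2l; first by rewrite lee_fin.
by apply/H12_norm_leP; rewrite ?sqrtr_ge0// sqr_sqrtr.
Qed.

Definition sobolev_null (f_ : nat -> H) : Prop :=
  forall e : R, 0 < e -> \forall N \near \oo, sobolev_le (f_ N) e.

Lemma sobolev_nullD (f_ g_ : nat -> H) : sobolev_null f_ -> sobolev_null g_ ->
  sobolev_null (fun N => f_ N + g_ N).
Proof.
move=> f0 g0 e e0; have e4 : 0 < e / 4 by rewrite divr_gt0.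
near=> N; apply: (@sobolev_leW _ _ (2 * (e / 4) + 2 * (e / 4))); first lra.
by apply: sobolev_leD; near: N; [exact: f0|exact: g0].
Unshelve. all: by end_near. Qed.

(** The operators may vary with N, but they share the bound [M]; this is how the family of
    projectors is applied to a null sequence. *)
Lemma sobolev_null_bounded_op (T_ : nat -> H -> H) (M : R) (f_ : nat -> H) :
  (forall N f B, sobolev_le f B -> sobolev_le (T_ N f) (M * B)) ->
  sobolev_null f_ -> sobolev_null (fun N => T_ N (f_ N)).
Proof.
move=> TM f0 e e0; have M1 : 0 < `|M| + 1 by rewrite ltr_wpDl.
near=> N; apply: (@sobolev_leW _ _ (M * (e / (`|M| + 1)))).
  rewrite mulrA ler_pdivrMr// mulrC ler_pM2l//.
  by rewrite (le_trans (ler_norm _))// lerDl.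
by apply: TM; near: N; apply: f0; rewrite divr_gt0.
Unshelve. all: by end_near. Qed.

Lemma sobolev_null0 : sobolev_null (fun=> 0).
Proof.
move=> e e0; near=> N => s us; rewrite big1 ?ltW// => k _.
rewrite /sobolev_term -(scale0r 0) fourier_coefZ mul0r.
by rewrite /sqnormc /= expr0n addr0 mulr0.
Unshelve. all: by end_near. Qed.

Lemma sobolev_nullZ a (f_ : nat -> H) : sobolev_null f_ -> sobolev_null (fun N => a *: f_ N).
Proof. by apply: (@sobolev_null_bounded_op (fun _ f => a *: f)) => N f B; exact: sobolev_leZ. Qed.

Lemma sobolev_null_cvg (f_ : nat -> H) : sobolev_null f_ -> H12_norm (f_ N) @[N --> \oo] --> 0%E.
Proof.
move=> f0; have n0 N : (0 <= H12_norm (f_ N))%E by exact: poweR_ge0.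
have le_near (e : R) : 0 < e -> \forall N \near \oo, (H12_norm (f_ N) <= e%:E)%E.
  move=> e0; near=> N; apply/H12_norm_leP; first exact: ltW.
  by near: N; apply: f0; rewrite exprn_gt0.
(* A limit 0 in the extended reals is handled through real parts, once the norms are finite. *)
have fin_near : \forall N \near \oo, H12_norm (f_ N) \is a fin_num.
  near=> N; rewrite ge0_fin_numE//; apply: (@le_lt_trans _ _ 1%:E); last exact: ltry.
  by near: N; exact: le_near.
apply/fine_cvgP; split => //; apply/cvgrPdist_le => e e0; near=> N.
rewrite sub0r normrN ger0_norm ?fine_ge0// -lee_fin fineK; last by near: N.
by near: N; exact: le_near.
Unshelve. all: by end_near. Qed.

(** Cauchy-Schwarz moves the question to the L^2 norm, and completeness of the modes bounds that by
    the Sobolev sums. *)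
Lemma sobolev_null_weak (f_ : nat -> H) psi : sobolev_null f_ ->
  (inner psi (f_ N) : C^o) @[N --> \oo] --> (0 : C^o).
Proof.
move=> f0; apply/cvgrPdist_le => -[e e'].
rewrite ltcE /= => /andP[/eqP -> e0].
have p1 : 0 < sqnorm psi + 1 by rewrite ltr_wpDl// sqnorm_ge0.
near=> N; rewrite sub0r normrN normc_def lecR.
have -> : e = Num.sqrt (e ^+ 2) by rewrite sqrtr_sqr gtr0_norm.
rewrite ler_sqrt ?sqr_ge0//; apply: (le_trans (cauchy_schwarz psi (f_ N))).
have fN : sobolev_le (f_ N) (e ^+ 2 / (sqnorm psi + 1)).
  by near: N; apply: f0; rewrite divr_gt0// exprn_gt0.
have := sqnorm_le_sobolev (trig_approximable_all _) fN.
move/(ler_wpM2l (sqnorm_ge0 psi))/le_trans; apply.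
by rewrite mulrA ler_pdivrMr// mulrC ler_wpM2l ?sqr_ge0// lerDl.
Unshelve. all: by end_near. Qed.

(** For a linear map, continuity at 0 is enough. Halving [d] turns the non-strict Sobolev bound into
    the strict one that continuity asks for. *)
Lemma H12_continuous_null (T : {linear H -> H}) (f_ : nat -> H) :
  H12_continuous T -> sobolev_null f_ -> sobolev_null (fun N => T (f_ N)).
Proof.
move=> [_ cT] f0 e e0; have H0 : H12 (0 : H).
  apply/H12P; exists 1; have [N _ /(_ N (leqnn N))] := sobolev_null0 ltr01; exact.
have se : 0 < Num.sqrt e by rewrite sqrtr_gt0.
have [d d0 Td] := cT _ H0 _ se.
near=> N; have fN : sobolev_le (f_ N) ((d / 2) ^+ 2).
  by near: N; apply: f0; rewrite exprn_gt0// divr_gt0.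
have -> : e = Num.sqrt e ^+ 2 by rewrite sqr_sqrtr// ltW.
apply/H12_norm_leP; first exact: ltW.
have := Td (f_ N); rewrite subr0 linear0 /= subr0 => h; apply/ltW/h.
  by apply/H12P; exists ((d / 2) ^+ 2).
apply: (@le_lt_trans _ _ (d / 2)%:E); last by rewrite lte_fin ltr_pdivrMr// ltr_pMr// ltr1n.
by apply/H12_norm_leP => //; rewrite divr_ge0// ltW.
Unshelve. all: by end_near. Qed.

(** The difference v - T v is orthogonal to both v and T v, which lie in [V], hence to itself. *)
Lemma orth_proj_fix (T : H -> H) (V : set H) v : is_orth_proj T V -> V v -> T v = v.
Proof.
move=> TV Vv; have [VT o] := TV v.
apply/eqP; rewrite eq_sym -subr_eq0; apply/eqP/sqnorm_eq0.
by rewrite sqnorm_inner innerDl -scaleN1r innerZl scaleN1r !o// mulr0 addr0.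
Qed.

Lemma orth_complement_eq0 (V : set H) f : V f -> orth_complement V f -> f = 0.
Proof. by move=> Vf of_; apply: sqnorm_eq0; rewrite sqnorm_inner of_. Qed.

(** [P] splits each vector along W and its orthogonal complement. On the latter, two solutions of U
    g + g = f differ by an element of W that is also orthogonal to W, hence by 0. *)
Lemma partial_cayley_unique (U P A A' : {linear H -> H}) :
  is_orth_proj P (eigenspace_op U (-1)) ->
  is_partial_cayley U A -> is_partial_cayley U A' -> A =1 A'.
Proof.
move=> hP [A0 A1] [A0' A1'] f; have [WP oP] := hP f.
have split_f (T : {linear H -> H}) : T f = T (f - P f) + T (P f).
  by rewrite -linearD subrK.
rewrite (split_f A) (split_f A') (A0 _ WP) (A0' _ WP); congr (_ + _).
have [g [og eg ->]] := A1 _ oP; have [g' [og' eg' ->]] := A1' _ oP.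
suff -> : g = g' by [].
have Wd : eigenspace_op U (-1) (g - g').
  rewrite /eigenspace_op /= linearB /= scaleN1r opprB.
  have E : U g + g = U g' + g' by rewrite eg eg'.
  by apply/eqP; rewrite subr_eq; apply/eqP; rewrite addrAC [g' + _]addrC -E addrK.
have od : orth_complement (eigenspace_op U (-1)) (g - g').
  by move=> v Wv; rewrite innerDr innerNr og// og'// subr0.
by apply/eqP; rewrite -subr_eq0; apply/eqP; exact: orth_complement_eq0 od.
Qed.

End SobolevNorm.

(** * Convergence of the projectors and of compressed operators *)

Section Projections.
Variable R : realType.
Notation H := (L2 R).
Variables (NS : nat -> nat) (x1 : nat -> R) (K : nat -> {linear H -> H}) (c : R).
Hypothesis NS0 : forall N, (0 < NS N)%N.
Hypothesis NSoo : NS @ \oo --> \oo.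
Hypothesis KV : forall N, is_orth_proj (K N) (PL_space (NS N) (x1 N)).
Hypothesis Kc : forall N f, H12 f -> (H12_norm (K N f) <= c%:E * H12_norm f)%E.

Lemma K_sobolev_le N f B : sobolev_le f B -> sobolev_le (K N f) (c ^+ 2 * B).
Proof. exact: sobolev_le_bounded_op (Kc N) _ _. Qed.

Lemma KB_sobolev_le N f B : sobolev_le f B ->
  sobolev_le (K N f - f) ((2 * c ^+ 2 + 2) * B).
Proof.
move=> fB; have -> : (2 * c ^+ 2 + 2) * B = 2 * (c ^+ 2 * B) + 2 * B by ring.
by apply: sobolev_leD; [exact: K_sobolev_le|exact: sobolev_leN].
Qed.

Lemma K_mode_cvg k : sobolev_null (fun N => K N (modeL2 R k) - modeL2 R k).
Proof.
move=> e e0.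
(* The mesh width is 4 / n, and (4 / n)^2 <= 16 / n since n >= 1. The weaker bound M / n is small as
   soon as n >= M / e. *)
pose M := (2 * c ^+ 2 + 2) * (160 * (mode_scale R * frequency R k ^+ 2) ^+ 2 * 16).
have a0 : 0 <= 2 * c ^+ 2 + 2 by rewrite addr_ge0// mulr_ge0// sqr_ge0.
have M0 : 0 <= M by rewrite mulr_ge0// mulr_ge0// mulr_ge0// sqr_ge0.
near=> N; have [v Vv ev] := mode_PL_approx k (x1 N) (NS0 N).
have -> : K N (modeL2 R k) - modeL2 R k = K N (modeL2 R k - v) - (modeL2 R k - v).
  by rewrite linearB /= (orth_proj_fix (KV N) Vv) opprB addrA subrK.
apply: sobolev_leW (KB_sobolev_le N ev).
have n1 : 1 <= (NS N)%:R :> R by rewrite ler1n.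
have Mn : M / e <= (NS N)%:R.
  apply: (@le_trans _ _ (Num.bound (M / e))%:R).
    by rewrite ltW// archi_boundP// divr_ge0// ltW.
  by rewrite ler_nat; near: N; move/cvgnyPge : NSoo; apply.
apply: (@le_trans _ _ (M / (NS N)%:R)).
  move: n1; set n := (NS N)%:R => n1; have n0 : 0 < n by exact: lt_le_trans n1.
  have -> : M / n = (2 * c ^+ 2 + 2) *
      (160 * (mode_scale R * frequency R k ^+ 2) ^+ 2 * (16 / n)).
    by rewrite /M; field; rewrite gt_eqF.
  have D0 : 0 <= 160 * (mode_scale R * frequency R k ^+ 2) ^+ 2.
    by apply: mulr_ge0 => //; exact: sqr_ge0.
  rewrite ler_wpM2l// ler_wpM2l//.
  have -> : (4 / n) ^+ 2 = 16 / n / n by field; rewrite gt_eqF.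
  by rewrite ler_piMr ?divr_ge0 ?(ltW n0)// invf_le1.
by rewrite ler_pdivrMr ?(lt_le_trans ltr01)// mulrC -ler_pdivrMr.
Unshelve. all: by end_near. Qed.

Lemma K_cvg f : H12 f -> sobolev_null (fun N => K N f - f).
Proof.
move=> /H12P[B fB] e e0; pose a : R := 2 * c ^+ 2 + 2.
have a0 : 0 < a by rewrite ltr_wpDl// mulr_ge0// sqr_ge0.
(* The tail is made smaller than e / (4 a), so that it contributes 2 a e / (4 a) = e / 2, and the
   finite part supplies the other half. *)
have [s us rs] := sobolev_residual fB (divr_gt0 e0 (mulr_gt0 (ltr0n R 4) a0)).
pose t := \sum_(k <- s) fourier_coef f k *: modeL2 R k.
have ft : f = residual s f + t by rewrite /residual subrK.
have tn : sobolev_null (fun N => K N t - t).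
  rewrite /t; elim: (s) => [|k r ih].
    under eq_fun do rewrite big_nil linear0 subr0; exact: sobolev_null0.
  under eq_fun do rewrite big_cons linearD linearZ opprD addrACA -scalerBr.
  by apply: sobolev_nullD => //; apply: sobolev_nullZ; exact: K_mode_cvg.
near=> N; have -> : K N f - f = (K N (residual s f) - residual s f) + (K N t - t).
  by rewrite {1 2}ft linearD opprD addrACA.
apply: (@sobolev_leW _ _ (2 * (a * (e / (4 * a))) + 2 * (e / 4))).
  by rewrite le_eqVlt; apply/orP; left; apply/eqP; field; rewrite gt_eqF.
apply: sobolev_leD; first exact: KB_sobolev_le.
by near: N; apply: tn; rewrite divr_gt0.
Unshelve. all: by end_near. Qed.

(** Preserving null sequences is the property shared by the two operators: [P] has it by continuity
    at 0, [A] by its H^{1/2} bound. The projectors are also applied to [T f], which must therefore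
    lie in H^{1/2}. *)
Lemma compression_cvg (T : {linear H -> H}) f : H12 f -> H12 (T f) ->
  (forall g_, sobolev_null g_ -> sobolev_null (fun N => T (g_ N))) ->
  sobolev_null (fun N => K N (T (K N f)) - T f).
Proof.
move=> Hf HTf Tnull.
have -> : (fun N => K N (T (K N f)) - T f) =
    (fun N => K N (T (K N f - f)) + (K N (T f) - T f)).
  by apply/funext => N; rewrite !linearB /= addrA subrK.
apply: sobolev_nullD; last exact: K_cvg.
apply: (@sobolev_null_bounded_op _ (fun N => K N) (c ^+ 2)).
  by move=> N g B; exact: K_sobolev_le.
by apply: Tnull; exact: K_cvg.
Qed.

End Projections.

Theorem proposition4p1 (R : realType)
    (U P A : {linear L2 R -> L2 R})
    (NS : nat -> nat) (x1 : nat -> R)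
    (K : nat -> {linear L2 R -> L2 R}) (c : R) :
  unitary_op U ->
  spectral_gap U ->
  admissible U ->
  is_orth_proj P (eigenspace_op U (-1)) ->
  is_partial_cayley U A ->
  H12_continuous P ->
  (forall N, (0 < NS N)%N) ->
  NS @ \oo --> \oo ->
  (forall N, is_orth_proj (K N) (PL_space (NS N) (x1 N))) ->
  (forall N f, H12 f -> (H12_norm (K N f) <= c%:E * H12_norm f)%E) ->
  (forall f, H12 f ->
     H12_norm (K N (P (K N f)) - P f) @[N --> \oo] --> 0%E) /\
  (forall psi f, H12 f ->
     (inner psi (K N (A (K N f)) - A f) : R[i]^o) @[N --> \oo] --> (0 : R[i]^o)).
Proof.
move=> _ _ [A' cA' [HA' [M AM]]] hP cA cP NS0 NSoo KV Kc.
have AA' := partial_cayley_unique hP cA cA'.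
split=> [f Hf|psi f Hf].
  apply: sobolev_null_cvg; apply: (compression_cvg NS0 NSoo KV Kc Hf) => [|g_ g0].
    exact: cP.1.
  exact: H12_continuous_null.
apply: sobolev_null_weak; apply: (compression_cvg NS0 NSoo KV Kc Hf) => [|g_ g0].
  by rewrite AA'; exact: HA'.
apply: (@sobolev_null_bounded_op _ (fun _ => A) (M ^+ 2)) => // N g B.
by rewrite AA'; exact: sobolev_le_bounded_op.
Qed.
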